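(* Let $\Gamma=\{1,\dots,m\}$, let $f_\gamma:\mathbb{R}^n\to\mathbb{R}^n$ ($\gamma\in\Gamma$) be continuous, write $f(\xi,\gamma)=f_\gamma(\xi)$, and consider the switched system $\dot x=f(x,\sigma)$. Let $\mathcal{T}'$ be a family of maximal trajectories of this system, and let $\chi=\{\chi_\gamma:\gamma\in\Gamma\}$ be a closed covering of $\mathbb{R}^n$ such that $\mathcal{T}'\subseteq\mathcal{T}[\chi]$. Put $\Gamma^*=\{\gamma\in\Gamma: 0\in\chi_\gamma\}$ and assume $f(0,\gamma)=0$ for all $\gamma\in\Gamma^*$. Assume also $\mathcal{T}'\subseteq\mathcal{T}_a$. Suppose that there exists a weak Lyapunov-like function $V$ for $\mathcal{T}'$. Suppose, in addition, that there exists a family $\{W_\gamma:\mathbb{R}^n\to\mathbb{R},\ \gamma\in\Gamma\}$ of continuous and nonnegative definite functions such that 1. $\frac{\partial V}{\partial\xi}(\xi,\gamma)f(\xi,\gamma)\le -W_\gamma(\xi)$ for all $(\xi,\gamma)\in\mathbb{R}^n\times\Gamma$ such that $\xi\in\chi_\gamma$; 2. for each $\gamma\in\Gamma$, the system $\dot x=f_\gamma(x)$, $y=W_\gamma(x)$ is zero small-time distinguishable. Then $\mathcal{T}'$ is globally asymptotically stable. If, in addition, $\mathcal{T}'\subseteq\mathcal{T}_a[\tau_D,N_0]$ for some $\tau_D>0$ and some $N_0\in\mathbb{N}$, then $\mathcal{T}'$ is globally uniformly asymptotically stable.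
   Context: Notation: $\mathbb{R}_+=[0,\infty)$, $\mathbb{N}$ is the set of positive integers, $|\cdot|$ is the Euclidean norm. $\alpha:\mathbb{R}_+\to\mathbb{R}_+$ is of class $\mathcal{K}$ if it is continuous, strictly increasing and $\alpha(0)=0$; of class $\mathcal{K}_\infty$ if in addition unbounded. $\beta:\mathbb{R}_+\times\mathbb{R}_+\to\mathbb{R}_+$ is of class $\mathcal{KL}$ if it is of class $\mathcal{K}_\infty$ in the first argument and decreases to zero in the second. $W_\gamma$ nonnegative definite means $W_\gamma(\xi)\ge0$ for all $\xi$. Zero small-time distinguishability. The system $\dot x=f_\gamma(x)$, $y=W_\gamma(x)$ is zero small-time distinguishable if for every $\delta>0$ and every solution $x$ of $\dot x=f_\gamma(x)$ on $[0,\delta)$: $x(0)=0$ whenever $W_\gamma(x(t))=0$ for all $t\in[0,\delta)$. Switched system. $\Gamma$ carries the discrete metric. A switching signal is a piecewise constant, right-continuous function $\sigma:\mathbb{R}_+\to\Gamma$. Its switching times are $t_0=0$ and its consecutive discontinuities $t_1<t_2<\cdots$ (finitely many, or infinitely many tending to $\infty$). A solution of $\dot x=f(x,\sigma)$ corresponding to $\sigma$ is a (continuous) piecewise smooth curve $x:\mathcal{I}\to\mathbb{R}^n$, $\mathcal{I}=[0,T)$ or $[0,T]$, $0<T\le\infty$, with $\dot x(t)=f(x(t),\sigma(t))$ for all $t\in(t_i,t_{i+1})\cap\mathcal{I}$ and all $i$ (with $t_{i+1}=\infty$ if $t_i$ is the last switching time). A trajectory is a pair $(x,\sigma)$ with $x$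 a solution corresponding to $\sigma$; it is maximal if $x$ is a maximal (non-extendable) solution, and its domain is then $\mathcal{I}_{(x,\sigma)}=[0,t_{(x,\sigma)})$. $\mathcal{T}$ is the set of all maximal trajectories. (If $x$ is bounded then $t_{(x,\sigma)}=\infty$.) A closed covering of $\mathbb{R}^n$ is a family $\chi=\{\chi_\gamma:\gamma\in\Gamma\}$ of closed sets with $\bigcup_\gamma\chi_\gamma=\mathbb{R}^n$. $\mathcal{T}[\chi]$ is the set of $(x,\sigma)\in\mathcal{T}$ with $x(t)\in\chi_{\sigma(t)}$ for all $t\in\mathcal{I}_{(x,\sigma)}$. Average dwell-time. $\sigma$ has average dwell-time $\tau_D>0$ and chatter bound $N_0\in\mathbb{N}$ if the number of switching times of $\sigma$ in any open finite interval $(\tau_1,\tau_2)\subset\mathbb{R}_+$ is at most $N_0+(\tau_2-\tau_1)/\tau_D$. $\mathcal{S}_a[\tau_D,N_0]$ is the set of such signals, $\mathcal{T}_a[\tau_D,N_0]$ the set of $(x,\sigma)\in\mathcal{T}$ with $\sigma\in\mathcal{S}_a[\tau_D,N_0]$, and $\mathcal{T}_a=\bigcup_{\tau_D>0,N_0\in\mathbb{N}}\mathcal{T}_a[\tau_D,N_0]$. Stability. A family $\mathcal{T}'$ of maximal trajectories is: uniformly stable if there is $\alpha\in\mathcal{K}_\infty$ such that for every $(x,\sigma)\in\mathcal{T}'$, $|x(t)|\le\alpha(|x(t_0)|)$ for all $t\ge t_0\ge0$ (including that $x$ is defined on $[0,\infty)$); globally asymptotically stable if it is uniformly stable and $x(t)\to0$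 as $t\to\infty$ for every $(x,\sigma)\in\mathcal{T}'$; globally uniformly asymptotically stable if there is $\beta\in\mathcal{KL}$ such that for every $(x,\sigma)\in\mathcal{T}'$, $|x(t)|\le\beta(|x(t_0)|,t-t_0)$ for all $t\ge t_0\ge0$. Weak Lyapunov-like function for $\mathcal{T}'$ (with the covering $\chi$): a function $V:\mathbb{R}^n\times\Gamma\to\mathbb{R}$, continuously differentiable in the first argument, such that (1) there are $\alpha_1,\alpha_2\in\mathcal{K}_\infty$ with $\alpha_1(|\xi|)\le V(\xi,\gamma)\le\alpha_2(|\xi|)$ for all $(\xi,\gamma)$ with $\xi\in\chi_\gamma$; (2) $\frac{\partial V}{\partial\xi}(\xi,\gamma)f(\xi,\gamma)\le0$ for all $(\xi,\gamma)$ with $\xi\in\chi_\gamma$; (3) for every $(x,\sigma)\in\mathcal{T}'$ and any switching times $t_i<t_j$ of $\sigma$ (in the domain of $x$) with $\sigma(t_i)=\sigma(t_j)$, $V(x(t_j),\sigma(t_j))\le V(x(t_{i+1}),\sigma(t_i))$. *)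

(* Defs.v *)
From HB Require Import structures.
From mathcomp Require Import all_boot all_order all_algebra.
From mathcomp Require Import all_classical all_reals all_analysis.

Set Implicit Arguments.
Unset Strict Implicit.
Unset Printing Implicit Defensive.

Import Order.TTheory GRing.Theory Num.Theory.
Import numFieldNormedType.Exports.

Local Open Scope classical_set_scope.
Local Open Scope ring_scope.

(* The library norm on 'rV[R]_n is the sup norm (it induces the same topology),
   hence the explicit Euclidean norm. *)
Definition enorm (R : realType) (n : nat) (u : 'rV[R]_n) : R :=
  Num.sqrt (\sum_(i < n) u 0 i ^+ 2).

(* Comparison functions on R_+ are total functions on R of which only the
   restriction to [0, +oo[ matters; nonnegativity of their values there follows
   from monotonicity and the value at 0. *)
Definition classK (R : realType) (a : R -> R) : Prop :=
  [/\ {within `[0, +oo[, continuous a},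
      (forall s t : R, 0 <= s -> s < t -> a s < a t) &
      a 0 = 0].

Definition classKoo (R : realType) (a : R -> R) : Prop :=
  classK a /\ forall M, exists2 s, 0 <= s & M < a s.

(* "Decreases" cannot be strict, since b 0 t = 0 for all t. *)
Definition classKL (R : realType) (b : R -> R -> R) : Prop :=
  (forall t : R, 0 <= t -> classKoo (b ^~ t)) /\
  (forall s : R, 0 <= s ->
     (forall t t' : R, 0 <= t -> t <= t' -> b s t' <= b s t) /\
     b s t @[t --> +oo] --> 0).

(* Derivative at t of a curve with domain D: two-sided at interior points of D,
   one-sided at the end points belonging to D. *)
Definition has_deriv_within (R : realType) (n : nat) (D : set R)
    (x : R -> 'rV[R]_n) (t : R) (v : 'rV[R]_n) : Prop :=
  (s - t)^-1 *: (x s - x t) @[s --> within D t^'] --> v.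

Definition zero_small_time_distinguishable (R : realType) (n : nat)
    (g : 'rV[R]_n -> 'rV[R]_n) (W : 'rV[R]_n -> R) : Prop :=
  forall (delta : R) (x : R -> 'rV[R]_n), 0 < delta ->
    (forall t : R, 0 <= t < delta ->
       has_deriv_within `[0, delta[ x t (g (x t))) ->
    (forall t : R, 0 <= t < delta -> W (x t) = 0) ->
    x 0 = 0.

(* Signals are total functions on R of which only the restriction to [0, +oo[
   matters. The negated clause is discontinuity at t for the discrete metric. *)
Definition switching_time (R : realType) (m : nat) (sigma : R -> 'I_m) :
    set R :=
  [set t : R | t = 0 \/ 0 < t /\ ~ (\forall s \near t, sigma s = sigma t)].

(* The second clause lists the switching times as 0 = t_0 < t_1 < ..., finitely
   many or tending to infinity; the signal is locally constant, hence constant,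
   on each interval between two consecutive ones. *)
Definition switching_signal (R : realType) (m : nat) (sigma : R -> 'I_m) :
    Prop :=
  (forall t : R, 0 <= t -> \forall s \near t^'+, sigma s = sigma t) /\
  (forall T : R, finite_set (switching_time sigma `&` `[0, T])).

(* s = t_(i+1) when t = t_i *)
Definition next_switching_time (R : realType) (m : nat) (sigma : R -> 'I_m)
    (t s : R) : Prop :=
  [/\ switching_time sigma t, switching_time sigma s, t < s &
      forall r, t < r < s -> ~ switching_time sigma r].

(* [0, T) and [0, T], for T possibly infinite *)
Definition horizon_co (R : realType) (T : \bar R) : set R :=
  [set t : R | 0 <= t /\ (t%:E < T)%E].
Definition horizon_cc (R : realType) (T : \bar R) : set R :=
  [set t : R | 0 <= t /\ (t%:E <= T)%E].

Definition solution_domain (R : realType) (I : set R) : Prop :=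
  exists2 T : \bar R, (0 < T)%E & I = horizon_co T \/ I = horizon_cc T.

(* The union of the open intervals between consecutive switching times is the
   complement of the set of switching times in [0, +oo[. Piecewise (C^1)
   smoothness of x is implied: with f_gamma and x continuous, the derivative of x
   is continuous on each of these intervals and has limits at their end points
   lying in I. *)
Definition is_solution (R : realType) (n m : nat)
    (f : 'rV[R]_n -> 'I_m -> 'rV[R]_n) (sigma : R -> 'I_m)
    (I : set R) (x : R -> 'rV[R]_n) : Prop :=
  [/\ solution_domain I,
      {within I, continuous x} &
      forall t, I t -> ~ switching_time sigma t ->
        has_deriv_within I x t (f (x t) (sigma t))].

(* A curve on [0, end_time) together with a signal; the values of the curve
   outside [0, end_time) are irrelevant. *)
Record trajectory (R : realType) (n m : nat) := Trajectory {
  curve : R -> 'rV[R]_n ;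
  signal : R -> 'I_m ;
  end_time : \bar R
}.

Definition dom (R : realType) (n m : nat) (p : trajectory R n m) : set R :=
  horizon_co (end_time p).

Definition maximal_trajectory (R : realType) (n m : nat)
    (f : 'rV[R]_n -> 'I_m -> 'rV[R]_n) : set (trajectory R n m) :=
  [set p | [/\ switching_signal (signal p),
      is_solution f (signal p) (dom p) (curve p) &
      forall (J : set R) (y : R -> 'rV[R]_n),
        is_solution f (signal p) J y ->
        dom p `<=` J ->
        (forall t, dom p t -> y t = curve p t) ->
        J = dom p]].

Definition closed_covering (R : realType) (n m : nat)
    (chi : 'I_m -> set 'rV[R]_n) : Prop :=
  (forall g, closed (chi g)) /\ \bigcup_(g : 'I_m) chi g = setT.

Definition covered_trajectory (R : realType) (n m : nat)
    (f : 'rV[R]_n -> 'I_m -> 'rV[R]_n) (chi : 'I_m -> set 'rV[R]_n) :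
    set (trajectory R n m) :=
  [set p | maximal_trajectory f p /\
           forall t, dom p t -> chi (signal p t) (curve p t)].

Definition average_dwell_time (R : realType) (m : nat) (tauD : R) (N0 : nat) :
    set (R -> 'I_m) :=
  [set sigma | switching_signal sigma /\
     forall t1 t2 : R, 0 <= t1 -> t1 < t2 ->
       exists2 k : nat,
         (switching_time sigma `&` `]t1, t2[ #= `I_k)%card &
         k%:R <= N0%:R + (t2 - t1) / tauD].

Definition adt_trajectory (R : realType) (n m : nat)
    (f : 'rV[R]_n -> 'I_m -> 'rV[R]_n) (tauD : R) (N0 : nat) :
    set (trajectory R n m) :=
  [set p | maximal_trajectory f p /\ average_dwell_time tauD N0 (signal p)].

Definition adt_trajectory_any (R : realType) (n m : nat)
    (f : 'rV[R]_n -> 'I_m -> 'rV[R]_n) : set (trajectory R n m) :=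
  [set p | exists (tauD : R) (N0 : nat),
     [/\ 0 < tauD, (0 < N0)%N & adt_trajectory f tauD N0 p]].

Definition uniformly_stable (R : realType) (n m : nat)
    (F : set (trajectory R n m)) : Prop :=
  exists2 a : R -> R, classKoo a &
    forall p, F p -> end_time p = +oo%E /\
      forall t0 t : R, 0 <= t0 -> t0 <= t ->
        enorm (curve p t) <= a (enorm (curve p t0)).

Definition globally_asymptotically_stable (R : realType) (n m : nat)
    (F : set (trajectory R n m)) : Prop :=
  uniformly_stable F /\
  forall p, F p -> curve p t @[t --> +oo] --> (0 : 'rV[R]_n).

Definition globally_uniformly_asymptotically_stable (R : realType) (n m : nat)
    (F : set (trajectory R n m)) : Prop :=
  exists2 b : R -> R -> R, classKL b &
    forall p, F p -> end_time p = +oo%E /\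
      forall t0 t : R, 0 <= t0 -> t0 <= t ->
        enorm (curve p t) <= b (enorm (curve p t0)) (t - t0).

Definition continuously_differentiable (R : realType) (n : nat)
    (h : 'rV[R]_n -> R) : Prop :=
  (forall xi, differentiable h xi) /\
  (forall v, continuous (fun xi => 'd h xi v)).

Definition weak_lyapunov_like (R : realType) (n m : nat)
    (f : 'rV[R]_n -> 'I_m -> 'rV[R]_n) (chi : 'I_m -> set 'rV[R]_n)
    (F : set (trajectory R n m)) (V : 'rV[R]_n -> 'I_m -> R) : Prop :=
  [/\ forall g, continuously_differentiable (V ^~ g),
      exists a1 a2 : R -> R, [/\ classKoo a1, classKoo a2 &
        forall xi g, chi g xi ->
          a1 (enorm xi) <= V xi g <= a2 (enorm xi)],
      forall xi g, chi g xi -> 'd (V ^~ g) xi (f xi g) <= 0 &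
      forall p, F p -> forall ti ti1 tj : R,
        next_switching_time (signal p) ti ti1 ->
        switching_time (signal p) tj -> ti < tj -> dom p tj ->
        signal p ti = signal p tj ->
        V (curve p tj) (signal p tj) <= V (curve p ti1) (signal p ti)].

(* Main.v *)
Require Import Defs.
From HB Require Import structures.
From mathcomp Require Import all_boot all_order all_algebra.
From mathcomp Require Import all_classical all_reals all_analysis.
From mathcomp Require Import ring lra.

(* Fix a trajectory and a time [t0]. At a fixed mode, V never increases from one
   activation to the next, so V at the current mode is bounded by its value when
   that mode was first entered; each new mode costs one application of
   alpha_1^-1 o alpha_2, whence |x(t)| <= (alpha_1^-1 o alpha_2)^m |x(t0)|.

   For attractivity, a compactness argument replaces LaSalle's principle: solutions
   of one mode on [- delta, delta] that stay in a ball and satisfy |y(0)| >= eps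
   decrease V by a uniform amount eta. Otherwise the limit along an ultrafilter of
   a sequence of counterexamples is a solution along which V is constant, so that
   W vanishes on it and y(0) = 0 by distinguishability. Average dwell-time provides
   in each block of fixed length a switching-free interval of fixed length; as the
   total decrease of V at each mode is bounded, only boundedly many blocks can
   avoid the eps-ball, which gives attraction uniform in the initial time and in
   bounded initial states. *)

Set Implicit Arguments.
Unset Strict Implicit.
Unset Printing Implicit Defensive.

Import Order.TTheory GRing.Theory Num.Theory.
Import numFieldNormedType.Exports.

Local Open Scope classical_set_scope.
Local Open Scope ring_scope.

(** * Comparison functions *)

(** Monotonicity and surjectivity suffice: the open interval from [h (g x - e)] to [h (g x + e)]
    contains [x], and [g] maps it into the open [e]-interval around [g x]. *)
Lemma increasing_bij_continuous {R : realType} (g h : R -> R) :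
  cancel h g -> {mono g : s t / s <= t} -> continuous g.
Proof.
move=> hK gmono x; apply/cvgrPdist_lt => e e0.
have glt := leW_mono gmono.
have lt1 : h (g x - e) < x by rewrite -glt hK; lra.
have lt2 : x < h (g x + e) by rewrite -glt hK; lra.
near=> y.
have y1 : g x - e < g y by rewrite -(hK (g x - e)) glt; near: y; exact: lt_nbhsr.
have y2 : g y < g x + e by rewrite -(hK (g x + e)) glt; near: y; exact: lt_nbhsl.
by rewrite ltr_distl; apply/andP; split; lra.
Unshelve. all: by end_near. Qed.

(** Continuing [a] by the identity on negative reals yields a bijection of the whole line, whose
    inverse and iterates are free of sign conditions. Surjectivity onto the nonnegative side is the
    intermediate value theorem together with unboundedness. *)
Lemma classKoo_extension {R : realType} (a : R -> R) : classKoo a ->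
  exists g h : R -> R, [/\ cancel g h, cancel h g,
    {mono g : s t / s <= t} & forall s, 0 <= s -> g s = a s].
Proof.
move=> [[acont aincr a0] aunb].
have a_ge0 s : 0 <= s -> 0 <= a s.
  rewrite le_eqVlt => /predU1P[<-|s0]; first by rewrite a0.
  by rewrite -a0 ltW// aincr.
pose g s := if 0 <= s then a s else s.
have ghomo : {homo g : s t / s < t}.
  move=> s t st; rewrite /g; case: (leP 0 s) => s0; case: (leP 0 t) => t0 //.
  - exact: aincr.
  - by move: (lt_trans st t0); rewrite ltNge s0.
  - by rewrite (lt_le_trans s0)// a_ge0.
have gmono := le_mono ghomo.
have gsurj y : exists s, g s = y.
  have [y0|y0] := leP 0 y; last by exists y; rewrite /g leNgt y0.
  have [S S0 yS] := aunb y.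
  have cS : {within `[0, S], continuous a}.
    apply: continuous_subspaceW acont => x /=.
    by rewrite !in_itv/= => /andP[->].
  have [|c] := IVT (v := y) S0 cS.
    by rewrite a0 min_l ?max_r ?a_ge0// y0 ltW.
  by rewrite in_itv/= => /andP[c0 _] <-; exists c; rewrite /g c0.
have [h hP] := choice gsurj.
exists g, h; split => //.
- by move=> s; apply: (inc_inj gmono); rewrite hP.
- by move=> s s0; rewrite /g s0.
Qed.

Lemma classKoo_increasing_bij {R : realType} (g h : R -> R) :
  cancel h g -> {mono g : s t / s <= t} -> g 0 = 0 -> classKoo g.
Proof.
move=> hK gmono g0; split; first split => //.
- exact/continuous_subspaceT/(increasing_bij_continuous hK).
- by move=> s t _; rewrite (leW_mono gmono).
- move=> M; exists (h (Num.max 0 M + 1)).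
    by rewrite -gmono hK g0 addr_ge0// le_max lexx.
  by rewrite hK ltr_pwDr// le_max lexx orbT.
Qed.

(* The majorant is [g (M s t) + s exp (- t)], where [M s t] is the supremum of
   the numbers [min (h v) (2 s - s')] over the triples [(s', t', v)] of [G] with
   [t <= t']. The cut-off [2 s - s'] makes [M] Lipschitz in [s] without spoiling
   the bound [h v <= s] at [s' = s]. *)
Lemma classKL_majorant {R : realType} (g h : R -> R) (G : R -> R -> R -> Prop) :
  cancel g h -> cancel h g -> {mono g : s t / s <= t} -> g 0 = 0 ->
  (forall s t v, G s t v -> [/\ 0 <= s, 0 <= v & v <= g s]) ->
  (forall r e, 0 < e -> exists T, forall s t v,
     G s t v -> s <= r -> T <= t -> v <= e) ->
  exists2 b, classKL b & forall s t v, G s t v -> v <= b s t.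
Proof.
move=> gK hK gmono g0 Gg Gcvg.
have hmono := can_mono hK gmono.
(* The element 0 keeps [S s t] nonempty and its supremum nonnegative, even when no triple
   qualifies. *)
pose S s t := [set w : R | w = 0 \/ exists s' t' v,
  [/\ G s' t' v, t <= t', w <= h v & w + s' <= 2 * s]].
pose M s t := sup (S s t).
have Sub s t : ubound (S s t) (Num.max 0 (2 * s)).
  move=> w [->|[s' [t' [v [/Gg[s'0 _ _] _ _ ws]]]]]; rewrite le_max ?lexx//.
  by apply/orP; right; lra.
have Ssup s t : has_sup (S s t).
  by split; [exists 0; left | exists (Num.max 0 (2 * s)); exact: Sub].
have M_ge0 s t : 0 <= M s t by apply: sup_upper_bound => //; left.
have M_le s t e : 0 <= e -> (forall w, S s t w -> 0 < w -> w <= e) -> M s t <= e.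
  move=> e0 Se; apply: ge_sup; first by exists 0; left.
  by move=> w Sw; have [w0|/(Se w Sw)//] := leP w 0; exact: le_trans e0.
have M0 t : M 0 t = 0.
  apply/eqP; rewrite eq_le M_ge0 andbT; apply: M_le => // w /Sub.
  by rewrite mulr0 maxxx.
have M_lip s s' t : s <= s' -> M s t <= M s' t <= M s t + 2 * (s' - s).
  move=> ss'; apply/andP; split; apply: M_le => //.
  - move=> w [->//|[s1 [t1 [v [Gv tt1 wv ws]]]]] _.
    by apply: sup_upper_bound => //; right; exists s1, t1, v; split => //; lra.
  - by have := M_ge0 s t; lra.
  - move=> w [->|[s1 [t1 [v [Gv tt1 wv ws]]]]] w0; first by have := M_ge0 s t; lra.
    (* [w - 2 * (s' - s)] meets the cut-off at [s], hence belongs to [S s t]. *)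
    rewrite -lerBlDr; apply: sup_upper_bound => //; right.
    by exists s1, t1, v; split => //; lra.
have M_cont t : continuous (M ^~ t).
  move=> s; apply/cvgrPdist_lt => e e0; near=> s'.
  have : `|s - s'| < e / 2.
    by near: s'; apply: cvgr_dist_lt => //; rewrite divr_gt0.
  rewrite ltr_distl ltr_distl => /andP[? ?].
  have [ss'|/ltW ss'] := leP s s'; have /andP[? ?] := M_lip _ _ t ss';
    by apply/andP; split; lra.
have M_dec s t t' : t <= t' -> M s t' <= M s t.
  move=> tt'; apply: M_le => // w [->//|[s1 [t1 [v [Gv tt1 wv ws]]]]] _.
  apply: sup_upper_bound => //; right; exists s1, t1, v; split => //.
  exact: le_trans tt1.
have g_cont := increasing_bij_continuous hK gmono.
(* The term [s * expR (- t)] makes the majorant strictly increasing and unbounded in [s], which [M]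
   alone need not ensure; it vanishes at [s = 0] and as [t] grows. *)
exists (fun s t => g (M s t) + s * expR (- t)); last first.
  move=> s t v Gv; have [s0 v0 vg] := Gg _ _ _ Gv.
  have hvs : h v <= s by rewrite -gmono hK.
  rewrite ler_wpDr ?mulr_ge0 ?expR_ge0// -[X in X <= _]hK gmono.
  by apply: sup_upper_bound => //; right; exists s, t, v; split => //; lra.
split.
- move=> t t0; split; first split.
  + apply: continuous_subspaceT => s; apply: cvgD.
      by apply: continuous_comp; [exact: M_cont | exact: g_cont].
    by apply: cvgM; [exact: cvg_id | exact: cvg_cst].
  + move=> s s' s0 ss'; rewrite ler_ltD ?gmono//.
      by have /andP[] := M_lip _ _ t (ltW ss').
    by rewrite ltr_pM2r ?expR_gt0.
  + by rewrite M0 g0 mul0r addr0.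
  + move=> K; exists ((Num.max 0 K + 1) / expR (- t)).
      by rewrite divr_ge0 ?expR_ge0// addr_ge0// le_max lexx.
    rewrite divfK ?gt_eqF ?expR_gt0// ltr_wpDl//; first by rewrite -g0 gmono.
    by rewrite ltr_pwDr// le_max lexx orbT.
- move=> s s0; split.
    move=> t t' t0 tt'; rewrite lerD ?gmono ?M_dec//.
    by rewrite ler_wpM2l// ler_expR lerN2.
  rewrite -[X in _ --> X]addr0 -[X in _ --> _ + X](mulr0 s); apply: cvgD; last first.
    by apply: cvgM; [exact: cvg_cst | exact: cvgr_expR].
  apply/cvgrPdist_le => e e0.
  (* A positive [w] in [S s t] comes from a triple with [s1 <= 2 * s], so one time [T] for the
     radius [2 * s] serves all of them. *)
  have [T Td] := Gcvg (2 * s) e e0.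
  near=> t; rewrite sub0r normrN ger0_norm -?[X in X <= _]g0 ?gmono//.
  rewrite -(hK e) gmono; apply: M_le; first by rewrite -gmono hK g0 ltW.
  move=> w [->|[s1 [t1 [v [Gv tt1 wv ws]]]]] w0.
    by rewrite -gmono hK g0 ltW.
  apply: (le_trans wv); rewrite hmono.
  apply: (Td _ _ _ Gv); first by lra.
  by apply: le_trans tt1; near: t; apply: nbhs_pinfty_ge; rewrite num_real.
Unshelve. all: by end_near. Qed.

(** * Derivatives of curves *)

(** Passes between the derivative along increments tending to 0 and the slopes at points tending to
    [t] that [has_deriv_within] uses. *)
Lemma is_derive1_slopeP {R : realType} {U : normedModType R} (x : R -> U)
    (t : R) (v : U) :
  is_derive t 1 x v <-> (s - t)^-1 *: (x s - x t) @[s --> t^'] --> v.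
Proof.
have shiftP (l : U) : (s - t)^-1 *: (x s - x t) @[s --> t^'] --> l <->
    h^-1 *: ((x \o shift t) (h *: 1) - x t) @[h --> 0^'] --> l.
  split=> /cvgrPdist_lt H; apply/cvgrPdist_lt => e /H /nbhs_ballP[d d0 Hd];
    apply/nbhs_ballP; exists d => // s; rewrite /ball/= => sd s0.
  - have := Hd (s + t); rewrite /ball/= opprD addrCA subrr addr0 -sub0r.
    rewrite addrK [s *: 1]mulr1; apply => //.
    by rewrite -subr_eq0 addrK.
  - have := Hd (s - t); rewrite /ball/= [(s - t) *: 1]mulr1 subrK sub0r opprB; apply => //.
    by rewrite subr_eq0.
split=> [xv|/shiftP xv].
  apply/shiftP; rewrite -[v](@derive_val _ _ _ _ _ _ _ xv).
  exact: (@ex_derive _ _ _ _ _ _ _ xv).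
by split; [exact: cvgP xv | exact: (cvg_lim _ xv)].
Qed.

Lemma has_deriv_within_interior {R : realType} n (D : set R)
    (x : R -> 'rV[R]_n) (t : R) v :
  nbhs t D -> has_deriv_within D x t v -> is_derive t 1 x v.
Proof.
move=> tD xv; apply/is_derive1_slopeP; apply: cvg_trans xv.
move=> P /= HP; have tD' : \forall s \near t^', D s by exact: nbhs_dnbhs tD.
have : (within D t^') (fun s => P ((s - t)^-1 *: (x s - x t))) by exact: HP.
rewrite /within/= => H; rewrite /nbhs/=; near=> s.
by apply: (near H s) => //; near: s.
Unshelve. all: by end_near. Qed.

Lemma is_derive_has_deriv_within {R : realType} n (D : set R)
    (x : R -> 'rV[R]_n) (t : R) v :
  is_derive t 1 x v -> has_deriv_within D x t v.
Proof.
move=> /is_derive1_slopeP xv; apply: cvg_trans xv => P HP.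
exact: (@cvg_within _ t^' _ D).
Qed.

Lemma is_derive1_coord {R : realType} n (x : R -> 'rV[R]_n) (t : R) v i :
  is_derive t 1 x v -> is_derive t 1 (fun s => x s 0 i) (v 0 i).
Proof.
move=> /is_derive1_slopeP xv; apply/is_derive1_slopeP.
have := cvg_comp _ _ xv (@coord_continuous R 1 n 0 i v).
by apply: cvg_trans; apply: near_eq_cvg; near=> s; rewrite /= !mxE.
Unshelve. all: by end_near. Qed.

Lemma is_derive1_continuous {R : realType} {U : normedModType R} (x : R -> U)
    (t : R) (v : U) : is_derive t 1 x v -> {for t, continuous x}.
Proof.
by move=> [xd _]; apply: differentiable_continuous; exact/derivable1_diffP.
Qed.

Lemma is_derive1_diff {R : realType} {U : normedModType R} (V : U -> R)
    (x : R -> U) (t : R) (v : U) : differentiable V (x t) ->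
  is_derive t 1 x v -> is_derive t 1 (V \o x) ('d V (x t) v).
Proof.
move=> dV [xd xv]; have dx : differentiable x t by exact/derivable1_diffP.
have dVx := differentiable_comp dx dV; split.
  exact/derivable1_diffP.
by rewrite (deriveE _ dVx) diff_comp//= -(deriveE _ dx) xv.
Qed.

Lemma rV_norm_leP {R : realType} n (u : 'rV[R]_n) e :
  0 <= e -> `|u| <= e <-> forall i, `|u 0 i| <= e.
Proof.
move=> e0; rewrite [`|u|]mx_normrE; split=> [ue i|ue].
  exact: le_trans (le_bigmax _ (fun ij => `|u ij.1 ij.2|) (0, i)) ue.
by apply: bigmax_le => // -[j i] _; rewrite ord1.
Qed.

Lemma within_continuous_comp {T U W : topologicalType} (D : set T) (x : T -> U)
    (g : U -> W) :
  {within D, continuous x} -> continuous g ->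
  {within D, continuous (fun t => g (x t))}.
Proof.
move=> /subspace_continuousP xc gc; apply/subspace_continuousP => t Dt.
exact: (cvg_comp _ _ (xc t Dt) (gc (x t))).
Qed.

(** The scalar mean value theorem is applied to each coordinate; the intermediate points differ, but
    the sup norm only needs a bound common to all coordinates. With [v = 0] this is a Lipschitz
    estimate; with [v] a value of the field it identifies derivatives of limit curves. *)
Lemma rV_mean_value {R : realType} n (x g : R -> 'rV[R]_n) a b e v :
  a <= b -> {within `[a, b], continuous x} ->
  (forall t, a < t < b -> is_derive t 1 x (g t) /\ `|g t - v| <= e) ->
  0 <= e ->
  `|x b - x a - (b - a) *: v| <= e * (b - a).
Proof.
rewrite le_eqVlt => /predU1P[<- _ _ e0|ab xc xd e0].
  by rewrite !subrr scale0r subrr normr0 mulr0.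
apply/rV_norm_leP => [|i]; first by rewrite mulr_ge0// subr_ge0 ltW.
have [||c] := @MVT _ (fun s => x s 0 i) (fun s => g s 0 i) a b ab.
- by move=> t; rewrite in_itv/= => /xd[+ _]; exact: is_derive1_coord.
- apply: (within_continuous_comp (g := fun u : 'rV_n => u 0 i) xc).
  exact: coord_continuous.
- rewrite in_itv/= => /xd[_ /(rV_norm_leP _ e0)/(_ i)] gv xab; rewrite !mxE in gv *.
  have ba : 0 <= b - a by rewrite subr_ge0 ltW.
  by rewrite xab (mulrC (b - a)) -mulrBl normrM (ger0_norm ba) ler_wpM2r.
Qed.

Lemma slopeC {R : realType} {U : normedModType R} (x : R -> U) (a b : R) :
  (a - b)^-1 *: (x a - x b) = (b - a)^-1 *: (x b - x a).
Proof. by rewrite -(opprB b) invrN scaleNr -scalerN opprB. Qed.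

Lemma slope_dist_le {R : realType} {U : normedModType R} (x : R -> U)
    (a b e : R) (v : U) :
  a < b -> `|x b - x a - (b - a) *: v| <= e * (b - a) ->
  `|v - (b - a)^-1 *: (x b - x a)| <= e.
Proof.
rewrite -subr_gt0 => ab xv.
have -> : v - (b - a)^-1 *: (x b - x a) =
    - (b - a)^-1 *: (x b - x a - (b - a) *: v).
  by rewrite [RHS]scalerBr scalerA mulNr mulVf ?gt_eqF// scaleN1r opprK scaleNr addrC.
by rewrite normrZ normrN gtr0_norm ?invr_gt0// ler_pdivrMl// mulrC.
Qed.

Lemma is_derive1_le0_nincr {R : realType} (g dg : R -> R) a b :
  a <= b -> {within `[a, b], continuous g} ->
  (forall t, a < t < b -> is_derive t 1 g (dg t) /\ dg t <= 0) -> g b <= g a.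
Proof.
rewrite le_eqVlt => /predU1P[<-//|ab] gc gd.
have [|c] := @MVT _ g dg a b ab _ gc.
- by move=> t; rewrite in_itv/= => /gd[].
- rewrite in_itv/= => /gd[_ dg0] gab.
  by rewrite -subr_le0 gab mulr_le0_ge0// subr_ge0 ltW.
Qed.

(** * The Euclidean norm: comparison with the sup norm, continuity, compact balls *)

Lemma enorm_ge0 {R : realType} n (u : 'rV[R]_n) : 0 <= enorm u.
Proof. exact: sqrtr_ge0. Qed.

Lemma enorm0 {R : realType} n : enorm (0 : 'rV[R]_n) = 0.
Proof. by rewrite /enorm big1 ?sqrtr0// => i _; rewrite mxE expr0n. Qed.

Lemma le_norm_enorm {R : realType} n (u : 'rV[R]_n) : `|u| <= enorm u.
Proof.
apply/(rV_norm_leP _ (enorm_ge0 _)) => i.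
rewrite -sqrtr_sqr ler_sqrt ?sumr_ge0// => [|j _]; last exact: sqr_ge0.
by rewrite (bigD1 i)//= lerDl sumr_ge0// => j _; exact: sqr_ge0.
Qed.

Lemma enorm_continuous {R : realType} n : continuous (@enorm R n).
Proof.
move=> u; apply: continuous_comp; last exact: sqrt_continuous.
have ci i : continuous (fun v : 'rV[R]_n => v 0 i ^+ 2).
  move=> v.
  exact: (cvg_comp _ _ (@coord_continuous R 1 n 0 i v) (@exprn_continuous R 2 (v 0 i))).
have := @continuous_big _ _ +%R 0 predT (@add_continuous R) _ (index_enum 'I_n)
  _ (fun i _ => ci i).
by apply.
Qed.

Lemma enorm_ball_compact {R : realType} n (C : R) :
  compact [set u : 'rV[R]_n | enorm u <= C].
Proof.
apply: bounded_closed_compact.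
  exists C; split; first exact: num_real.
  by move=> M CM u /= uC; rewrite (le_trans (le_norm_enorm u))// (le_trans uC)// ltW.
have := @closed_comp _ _ (@enorm R n) [set y | y <= C].
by apply; [move=> u _; exact: enorm_continuous | exact: closed_le].
Qed.

(** * Switching signals *)

Lemma finite_set_max {R : realType} (A : set R) x0 : finite_set A -> A x0 ->
  exists2 x, A x & forall y, A y -> y <= x.
Proof.
move=> /finite_seqP[s ->]; elim: s x0 => [//|x s IHs] x0 _.
case: s IHs => [_|z s IHs].
  by exists x => [|y]; rewrite /= inE// => /eqP->.
have [w ws wmax] := IHs z (mem_head _ _).
exists (Num.max x w) => [|y]; rewrite /= in_cons.
  by rewrite maxEle; case: ifP => _; rewrite ?ws ?eqxx ?orbT.
by rewrite le_max => /predU1P[->|/wmax->]; rewrite ?lexx ?orbT.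
Qed.

Lemma finite_set_min {R : realType} (A : set R) x0 : finite_set A -> A x0 ->
  exists2 x, A x & forall y, A y -> x <= y.
Proof.
move=> Afin Ax0.
have [_ [x Ax <-] xmax] := finite_set_max (finite_image -%R Afin) (imageP -%R Ax0).
by exists x => // y Ay; rewrite -lerN2; apply: xmax; exists y.
Qed.

(** Read as a real-valued function, the signal has zero derivative off the switching times, so the
    mean value theorem makes it constant on the open interval. Right-continuity carries the value to
    [a], which may itself be a switching time. *)
Lemma switching_free_constant {R : realType} m (sigma : R -> 'I_m) (a b t : R) :
  switching_signal sigma -> 0 <= a ->
  (forall r : R, a < r < b -> ~ switching_time sigma r) ->
  a <= t < b -> sigma t = sigma a.
Proof.
move=> [sright _] a0 nosw /andP[]; rewrite le_eqVlt => /predU1P[<-//|a_t] tb.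
have [s [sa st <-]] : exists s, [/\ a < s, s < t & sigma s = sigma a].
  near a^'+ => s; exists s; split; near: s.
  - exact: nbhs_right_gt.
  - exact: nbhs_right_lt.
  - exact: sright.
pose g r : R := (sigma r)%:R.
have gd (r : R) : a < r < b -> is_derive r 1 g 0.
  move=> /[dup] /nosw nosr /andP[ar _]; apply/is_derive1_slopeP.
  have /contrapT sr : ~ ~ (\forall s \near r, sigma s = sigma r).
    by move=> nsr; apply: nosr; right; split => //; exact: le_lt_trans ar.
  have sr' : \forall s \near r^', sigma s = sigma r by exact: nbhs_dnbhs sr.
  suff : \forall u \near r^', (u - r)^-1 *: (g u - g r) = 0 :> R.
    exact: cvg_near_cst.
  near=> u; suff -> : g u = g r by rewrite subrr scaler0.
  by rewrite /g; suff -> : sigma u = sigma r by []; near: u.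
have [||c _ /eqP] := @MVT _ g (fun=> 0) s t st.
- move=> v; rewrite in_itv/= => /andP[sv vt].
  by apply: gd; rewrite (lt_trans sa)//= (lt_trans vt).
- apply/subspace_continuousP => v; rewrite /= in_itv/= => /andP[sv vt].
  apply: cvg_within_filter; apply: is_derive1_continuous.
  by apply: gd; rewrite (lt_le_trans sa)//= (le_lt_trans vt).
- by rewrite mul0r subr_eq0 eqr_nat => /eqP/val_inj.
Unshelve. all: by end_near. Qed.

Lemma switching_free_constant_right {R : realType} m (sigma : R -> 'I_m)
    (a t : R) :
  switching_signal sigma -> 0 <= a -> a <= t ->
  (forall r : R, a < r <= t -> ~ switching_time sigma r) ->
  sigma t = sigma a.
Proof.
move=> ssig a0; rewrite le_eqVlt => /predU1P[<-//|a_t] nosw.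
have /contrapT st : ~ ~ (\forall s \near t, sigma s = sigma t).
  move=> nst; apply: (nosw t); first by rewrite a_t lexx.
  by right; split => //; exact: le_lt_trans a_t.
have sl : \forall s \near t^'-, sigma s = sigma t by exact: cvg_within.
have [s [as_ st' <-]] : exists s, [/\ a < s, s < t & sigma s = sigma t].
  near t^'- => s; exists s; split; near: s => //.
  - exact: nbhs_left_gt.
  - exact: nbhs_left_lt.
apply: switching_free_constant (ssig) a0 _ (_ : a <= s < t).
  by move=> r /andP[ar rt]; apply: nosw; rewrite ar ltW.
by rewrite ltW.
Unshelve. all: by end_near. Qed.

Lemma last_switching_time {R : realType} m (sigma : R -> 'I_m) (t : R) :
  switching_signal sigma -> 0 <= t ->
  exists s, [/\ switching_time sigma s, 0 <= s <= t &
    forall r, s < r <= t -> ~ switching_time sigma r].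
Proof.
move=> [_ sfin] t0.
have S0 : (switching_time sigma `&` `[0, t]) 0.
  by split; [left | rewrite /= in_itv/= lexx].
have [s [sw]] := finite_set_max (sfin t) S0.
rewrite /= in_itv/= => st smax; exists s; split => // r /andP[sr rt] swr.
have /smax : (switching_time sigma `&` `[0, t]) r.
  split=> //; rewrite /= in_itv/= rt andbT (le_trans _ (ltW sr))//.
  by case/andP: st.
by rewrite leNgt sr.
Qed.

Lemma first_switching_time {R : realType} m (sigma : R -> 'I_m) (a b : R) :
  switching_signal sigma -> 0 <= a -> a < b -> switching_time sigma b ->
  exists s, [/\ switching_time sigma s, a < s <= b &
    forall r, a < r < s -> ~ switching_time sigma r].
Proof.
move=> [_ sfin] a0 ab swb.
have Sb : (switching_time sigma `&` `]a, b]) b.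
  by split=> //; rewrite /= in_itv/= ab lexx.
have Sfin : finite_set (switching_time sigma `&` `]a, b]).
  apply: sub_finite_set (sfin b) => r [swr]; rewrite /= !in_itv/= => /andP[ar rb].
  by split=> //; rewrite rb (le_trans a0 (ltW ar)).
have [s [sw]] := finite_set_min Sfin Sb.
rewrite /= in_itv/= => /andP[as_ sb] smin.
exists s; split => //; first by rewrite as_.
move=> r /andP[ar rs] swr.
have /smin : (switching_time sigma `&` `]a, b]) r.
  by split=> //; rewrite /= in_itv/= ar (le_trans (ltW rs)).
by rewrite leNgt rs.
Qed.

(** The infimum of the visits is itself a visit: otherwise visits would come arbitrarily close to it
    from the right, where right-continuity fixes the signal. *)
Lemma first_visit {R : realType} m (sigma : R -> 'I_m) (a b : R) :
  switching_signal sigma -> 0 <= a -> a <= b ->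
  exists s, [/\ a <= s <= b, sigma s = sigma b &
    forall r, a <= r < s -> sigma r <> sigma b].
Proof.
move=> [sright _] a0 ab.
pose A := [set s | a <= s <= b /\ sigma s = sigma b].
have Ab : A b by split=> //; rewrite ab lexx.
have Alb : lbound A a by move=> r [/andP[]].
have Ainf : has_inf A by split; [exists b | exists a].
pose s := inf A.
have a_s : a <= s by apply: lb_le_inf => //; exists b.
have sb : s <= b by apply: ge_inf => //; exists a.
have s_min r : a <= r < s -> sigma r <> sigma b.
  move=> /andP[ar rs] rb; have : s <= r.
    apply: ge_inf; first by exists a.
    by split=> //; rewrite ar (le_trans (ltW rs)).
  by rewrite leNgt rs.
exists s; split => //; first by rewrite a_s.
have := sright s (le_trans a0 a_s).
rewrite /at_right /within/= => /nbhs_ballP[d d0 sd].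
have [r [rab rE] rs] := inf_adherent d0 Ainf.
have : s <= r by apply: ge_inf => //; exists a.
rewrite le_eqVlt => /predU1P[->//|sr].
rewrite -rE; apply/esym; apply: sd => //.
rewrite /ball/= ltr_distlC; rewrite -/s in rs; lra.
Qed.

(** * Monotonicity of V and stability *)

Lemma dom_le {R : realType} n m (p : trajectory R n m) (t b : R) :
  dom p b -> 0 <= t <= b -> dom p t.
Proof.
move=> [_ bT] /andP[t0 tb]; split=> //.
by apply: le_lt_trans bT; rewrite lee_fin.
Qed.

Lemma trajectory_continuous_segment {R : realType} n m
    (f : 'rV[R]_n -> 'I_m -> 'rV[R]_n) p (a b : R) :
  maximal_trajectory f p -> 0 <= a -> dom p b ->
  {within `[a, b], continuous (curve p)}.
Proof.
move=> [_ [_ xc _] _] a0 bD; apply: continuous_subspaceW xc => t /=.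
rewrite in_itv/= => /andP[at_ tb]; apply: dom_le bD _.
by rewrite tb (le_trans a0).
Qed.

Lemma trajectory_left_cvg {R : realType} n m
    (f : 'rV[R]_n -> 'I_m -> 'rV[R]_n) p (a b : R) :
  maximal_trajectory f p -> 0 <= a -> a < b -> dom p b ->
  curve p t @[t --> b^'-] --> curve p b.
Proof.
move=> pmax a0 ab bD.
by have /continuous_within_itvP - /(_ ab)[] :=
  trajectory_continuous_segment pmax a0 bD.
Qed.

Lemma trajectory_derive {R : realType} n m
    (f : 'rV[R]_n -> 'I_m -> 'rV[R]_n) p (a b t : R) :
  maximal_trajectory f p -> 0 <= a -> dom p b ->
  (forall r, a < r < b -> ~ switching_time (signal p) r) ->
  a < t < b -> is_derive t 1 (curve p) (f (curve p t) (signal p a)).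
Proof.
move=> [ps [_ _ xd] _] a0 bD nosw /[dup] atb /andP[at_ tb].
have [ta tD] : a <= t < b /\ dom p t.
  rewrite (ltW at_) tb; split=> //; apply: dom_le bD _.
  by rewrite (ltW tb) (le_trans a0 (ltW at_)).
rewrite -(switching_free_constant ps a0 nosw ta).
apply: has_deriv_within_interior (xd t tD (nosw t atb)).
apply: filterS (near_in_itvoo (_ : t \in `]a, b[)); last by rewrite in_itv/= at_.
move=> r; rewrite /= in_itv/= => /andP[ar rb]; apply: dom_le bD _.
by rewrite (ltW rb) (le_trans a0 (ltW ar)).
Qed.

Section lyapunov.
Context {R : realType} {n m : nat}.
Variables (f : 'rV[R]_n -> 'I_m -> 'rV[R]_n) (chi : 'I_m -> set 'rV[R]_n).
Variables (V : 'rV[R]_n -> 'I_m -> R) (p : trajectory R n m).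
Hypothesis chi_closed : forall g, closed (chi g).
Hypothesis V_diff : forall g xi, differentiable (V ^~ g) xi.
Hypothesis V_nincr : forall xi g, chi g xi -> 'd (V ^~ g) xi (f xi g) <= 0.
Hypothesis p_chi : covered_trajectory f chi p.
Hypothesis p_nincr : forall ti ti1 tj : R,
  next_switching_time (signal p) ti ti1 -> switching_time (signal p) tj ->
  ti < tj -> dom p tj -> signal p ti = signal p tj ->
  V (curve p tj) (signal p tj) <= V (curve p ti1) (signal p ti).

(** At [b] the signal may already have switched; membership there comes from the left limit of the
    curve and closedness of [chi]. *)
Lemma trajectory_mode_covered (a b t : R) : 0 <= a -> dom p b ->
  (forall r, a < r < b -> ~ switching_time (signal p) r) ->
  a <= t <= b -> chi (signal p a) (curve p t).
Proof.
have [pmax pchi] := p_chi; have [ps _ _] := pmax.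
move=> a0 bD nosw /andP[]; rewrite le_eqVlt => /predU1P[<- ab|at_ tb].
  by apply: pchi; apply: dom_le bD _; rewrite a0.
move: at_ tb; rewrite le_eqVlt => at_ /predU1P[tb|tb]; last first.
  rewrite -(switching_free_constant ps a0 nosw (t := t)) ?(ltW at_)//.
  by apply: pchi; apply: dom_le bD _; rewrite (ltW tb) (le_trans a0 (ltW at_)).
rewrite tb in at_ *.
apply: (closed_cvg (chi (signal p a)) (@chi_closed _) _ _
  (trajectory_left_cvg pmax a0 at_ bD)).
near=> s; have as_ : a < s by near: s; exact: nbhs_left_gt.
have sb : s < b by near: s; exact: nbhs_left_lt.
rewrite -(switching_free_constant ps a0 nosw (t := s)) ?(ltW as_)//.
by apply: pchi; apply: dom_le bD _; rewrite (ltW sb) (le_trans a0 (ltW as_)).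
Unshelve. all: by end_near. Qed.

Lemma V_nincr_between_switches (a b : R) : 0 <= a -> a <= b -> dom p b ->
  (forall r, a < r < b -> ~ switching_time (signal p) r) ->
  V (curve p b) (signal p a) <= V (curve p a) (signal p a).
Proof.
move=> a0 ab bD nosw; have [pmax _] := p_chi.
apply: (@is_derive1_le0_nincr _ (fun t => V (curve p t) (signal p a))
  (fun t => 'd (V ^~ (signal p a)) (curve p t) (f (curve p t) (signal p a)))) => //.
  apply: (within_continuous_comp (g := V ^~ (signal p a))
    (trajectory_continuous_segment pmax a0 bD)).
  by move=> xi; exact: differentiable_continuous.
move=> t atb; split.
  by apply: is_derive1_diff; [exact: V_diff |
    exact: trajectory_derive pmax a0 bD nosw atb].
apply/V_nincr/(trajectory_mode_covered a0 bD nosw).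
by case/andP: atb => /ltW -> /ltW ->.
Qed.

(** Extends the condition on switching times to arbitrary times. If a switch occurs in between, let
    [s] be the first one after [a], and [u], [v] the last switching times up to [a] and up to [b]. V
    does not increase from [a] to [s] nor from [v] to [b], where the mode is the same, and the
    Lyapunov condition for [u], its successor [s] and [v] bridges the gap. *)
Lemma V_nincr_same_mode (a b : R) : 0 <= a -> a <= b -> dom p b ->
  signal p a = signal p b ->
  V (curve p b) (signal p b) <= V (curve p a) (signal p a).
Proof.
move=> a0 ab bD sab; have [[ps _ _] _] := p_chi.
have [nosw|] := pselect (forall r, a < r <= b -> ~ switching_time (signal p) r).
  rewrite -sab; apply: V_nincr_between_switches => // r /andP[ar rb].
  by apply: nosw; rewrite ar ltW.
move=> /existsNP[r /not_implyP[/andP[ar rb] /contrapT swr]].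
have [s [sw /andP[as_ sr] s_min]] := first_switching_time ps a0 ar swr.
have [u [uw /andP[u0 ua] u_max]] := last_switching_time ps a0.
have [v [vw /andP[v0 vb] v_max]] := last_switching_time ps (le_trans a0 ab).
have sv : s <= v.
  rewrite leNgt; apply/negP => vs; apply: (v_max s) => //.
  by rewrite vs (le_trans sr).
have usE : signal p a = signal p u.
  exact: switching_free_constant_right ps u0 ua u_max.
have vE : signal p b = signal p v.
  exact: switching_free_constant_right ps v0 vb v_max.
have su : u < s by exact: le_lt_trans as_.
have s_next : next_switching_time (signal p) u s.
  split=> // q /andP[uq qs]; have [qa|aq] := leP q a.
    by apply: u_max; rewrite uq.
  by apply: s_min; rewrite aq.
have vD : dom p v by apply: dom_le bD _; rewrite v0.
have sD : dom p s by apply: dom_le vD _; rewrite sv (le_trans a0 (ltW as_)).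
apply: (@le_trans _ _ (V (curve p v) (signal p v))).
  rewrite vE; apply: V_nincr_between_switches => // r' /andP[vr rb'].
  by apply: v_max; rewrite vr ltW.
apply: (@le_trans _ _ (V (curve p s) (signal p u))).
  by apply: p_nincr => //; [exact: lt_le_trans sv | rewrite -usE sab vE].
by rewrite -usE; apply: V_nincr_between_switches => //; exact: ltW.
Qed.

(* Induction on the number [k] of modes visited since [t0]: when the current
   mode was entered for the first time, one mode fewer had been visited, and from
   that time on [V] at the current mode has not increased. *)
Lemma V_mode_count_bound (g1 h1 g2 : R -> R) (k : nat) (A : {set 'I_m})
    (t0 t : R) :
  cancel g1 h1 -> cancel h1 g1 -> {mono g1 : r s / r <= s} ->
  {homo g2 : r s / r <= s} -> (forall r, 0 <= r -> g1 r <= g2 r) ->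
  (forall xi g, chi g xi -> g1 (enorm xi) <= V xi g <= g2 (enorm xi)) ->
  (#|A| <= k)%N -> 0 <= t0 -> t0 <= t -> dom p t ->
  (forall s, t0 <= s <= t -> signal p s \in A) ->
  V (curve p t) (signal p t) <= g1 (iter k (h1 \o g2) (enorm (curve p t0))).
Proof.
move=> g1K h1K g1mono g2homo g12 Vbnd.
have [pmax pchi] := p_chi; have [ps _ _] := pmax.
pose rho := h1 \o g2; set r0 := enorm (curve p t0).
(* Since [g1 <= g2], [rho] is at least the identity on nonnegative reals; this settles the case
   [s = t0]. *)
have rho_ge j : r0 <= iter j rho r0.
  elim: j => //= j IHj; rewrite -g1mono h1K.
  by rewrite (le_trans _ (g2homo _ _ IHj))// (le_trans _ (g12 _ _))// enorm_ge0.
elim: k A t => [|k IHk] A t.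
  rewrite leqn0 cards_eq0 => /eqP-> t00 t0t _ /(_ t).
  by rewrite t0t lexx inE => /(_ erefl).
move=> Ak t00 t0t tD tA; have [s [/andP[t0s st] sE s_min]] := first_visit ps t00 t0t.
have sD : dom p s by apply: dom_le tD _; rewrite st (le_trans t00).
rewrite (le_trans (V_nincr_same_mode _ st tD sE))//; first exact: le_trans t0s.
have /Vbnd/andP[_ /le_trans->//] := pchi _ sD.
rewrite /= h1K g2homo//.
move: t0s; rewrite le_eqVlt => /predU1P[<-|t0s]; first exact: rho_ge.
(* Just before [s] the mode of [t] has not occurred since [t0], so the induction hypothesis applies
   with that mode removed from [A]; the bound on the norm reaches [s] by continuity. *)
have lim := trajectory_left_cvg pmax t00 t0s sD.
apply: (closed_cvg [set y : R | y <= iter k rho r0] (@closed_le R _) _ _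
  (cvg_comp _ _ lim (@enorm_continuous R n (curve p s)))).
near=> u => /=.
have t0u : t0 < u by near: u; exact: nbhs_left_gt.
have us : u < s by near: u; exact: nbhs_left_lt.
have uD : dom p u by apply: dom_le sD _; rewrite (ltW us) (le_trans t00 (ltW t0u)).
have /Vbnd/andP[Vu _] := pchi _ uD.
rewrite -g1mono (le_trans Vu)// (IHk (A :\ signal p t))//.
- rewrite -ltnS (leq_trans _ Ak)// [in X in (_ < X)%N](cardsD1 (signal p t)) tA//.
  by rewrite t0t lexx.
- exact: ltW.
- move=> q /andP[t0q qu]; rewrite in_setD1 tA ?andbT.
    by apply/eqP/s_min; rewrite t0q (le_lt_trans qu).
  by rewrite t0q (le_trans qu)// (le_trans (ltW us)).
Unshelve. all: by end_near. Qed.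
End lyapunov.

(** * Completeness of bounded trajectories *)

Lemma has_deriv_within_near_eq {R : realType} n (D E : set R)
    (x y : R -> 'rV[R]_n) (t : R) v :
  (\forall s \near t, E s -> D s /\ y s = x s) -> y t = x t ->
  has_deriv_within D x t v -> has_deriv_within E y t v.
Proof.
move=> DE yx xv; apply: cvg_trans xv => P /= HP.
have DE' : \forall s \near t^', E s -> D s /\ y s = x s by exact: nbhs_dnbhs DE.
have : (within D t^') (fun s => P ((s - t)^-1 *: (x s - x t))) by exact: HP.
rewrite /within/= => H; rewrite /nbhs/= /within/=; near=> s => Es.
have [||Ds ys] // := near DE' s; rewrite ys yx.
by apply: (near H s) => //; near: s.
Unshelve. all: by end_near. Qed.

Lemma continuous_ball_bounded {R : realType} n n' (g : 'rV[R]_n -> 'rV[R]_n') (C : R) :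
  continuous g -> exists2 M, 0 < M & forall u, enorm u <= C -> `|g u| <= M.
Proof.
move=> gc; have := continuous_compact (continuous_subspaceT gc) (@enorm_ball_compact R n C).
move=> /compact_bounded[M [Mreal HM]]; exists (Num.max M 0 + 1).
  by rewrite ltr_wpDl// le_max lexx orbT.
move=> u uC; apply: (HM (Num.max M 0 + 1)); last by exists u.
by rewrite ltr_pwDr// le_max lexx.
Qed.

(** If the end time [r] were finite, the field would be bounded along the curve, so the curve would
    be Lipschitz near [r] and have a limit [z] there. Adding the value [z] at [r] gives a solution
    on the closed interval, against maximality. *)
Lemma bounded_trajectory_complete {R : realType} n m
    (f : 'rV[R]_n -> 'I_m -> 'rV[R]_n) (p : trajectory R n m) (C : R) :
  (forall g, continuous (f ^~ g)) -> maximal_trajectory f p ->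
  (forall t, dom p t -> enorm (curve p t) <= C) -> end_time p = +oo%E.
Proof.
move=> f_cont pmax xC; have [ps [pdom xc xd] p_ext] := pmax.
have D0 : dom p 0.
  by case: pdom => T T0 [->|->]; split=> //; exact: ltW.
case ET : (end_time p) => [r| |] //; last by case: D0; rewrite ET.
have domE t : dom p t <-> 0 <= t < r.
  rewrite /dom /horizon_co/= ET lte_fin.
  by split=> [[-> ->]|/andP[-> ->]].
have r0 : 0 < r by move/domE: D0 => /andP[].
have [a [a0 ar a_max]] : exists a, [/\ 0 <= a, a < r &
    forall s, a < s < r -> ~ switching_time (signal p) s].
  have Sfin : finite_set (switching_time (signal p) `&` `[0, r[).
    apply: sub_finite_set (ps.2 r) => s [sw]; rewrite /= !in_itv/= => /andP[s0 sr].
    by split=> //; rewrite s0 ltW.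
  have S0 : (switching_time (signal p) `&` `[0, r[) 0.
    by split; [left | rewrite /= in_itv/= lexx].
  have [a [asw]] := finite_set_max Sfin S0.
  rewrite /= in_itv/= => /andP[a0 ar] amax; exists a; split => // s /andP[as_ sr] sw.
  have /amax : (switching_time (signal p) `&` `[0, r[) s.
    by split=> //; rewrite /= in_itv/= sr (le_trans a0 (ltW as_)).
  by rewrite leNgt as_.
set x := curve p in xC xc xd p_ext *; pose g := signal p a.
have xder t : a < t < r -> is_derive t 1 x (f (x t) g).
  move=> /andP[at_ tr]; have bD : dom p ((t + r) / 2) by apply/domE; lra.
  apply: (trajectory_derive pmax a0 bD); last by lra.
  by move=> s /andP[as_ sb]; apply: a_max; lra.
have [M M0 fM] := continuous_ball_bounded C (f_cont g).
have x_lip s t : a < s -> s <= t -> t < r -> `|x t - x s| <= M * (t - s).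
  move=> as_ st tr; rewrite -[x t - x s]subr0 -[X in `|_ - X|](scaler0 _ (t - s)).
  apply: (rV_mean_value (g := fun u => f (x u) g)) => //; last exact: ltW.
    by apply: trajectory_continuous_segment pmax _ _; [lra | apply/domE; lra].
  move=> u /andP[su ut]; split; first by apply: xder; lra.
  by rewrite subr0 fM// xC//; apply/domE; lra.
(* Compactness gives only a cluster point; the Lipschitz estimate then shows in [xz] that it is the
   limit. *)
have [z [zC z_cl]] : [set u | enorm u <= C] `&` cluster (x t @[t --> r^'-]) !=set0.
  apply: (@enorm_ball_compact R n C).
  have : \forall t \near r^'-, enorm (x t) <= C; last by [].
  near=> t; apply: xC; apply/domE/andP; split.
    by near: t; exact: nbhs_left_ge.
  by near: t; exact: nbhs_left_lt.
have xz s : a < s < r -> `|z - x s| <= M * (r - s).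
  move=> /andP[as_ sr]; apply/ler_addgt0Pr => e e0.
  have xF : (x t @[t --> r^'-]) (x @` `]s, r[).
    have : \forall t \near r^'-, (x @` `]s, r[) (x t); last by [].
    near=> t; exists t => //; rewrite /= in_itv/=; apply/andP; split; near: t.
      exact: nbhs_left_gt.
    exact: nbhs_left_lt.
  have [_ [[t + <-]]] := z_cl _ _ xF (nbhsx_ballx z e e0).
  rewrite /= in_itv/= => /andP[st tr]; rewrite -ball_normE/= => zt.
  rewrite -(subrKA (x t)) (le_trans (ler_normD _ _))// addrC lerD//; last exact: ltW.
  rewrite (le_trans (x_lip s t _ _ _))//; first exact: ltW.
  by rewrite ler_pM2l//; lra.
pose y t := if t < r then x t else z.
have yr : y r = z by rewrite /y ltxx.
have J_near t : horizon_cc r%:E t -> t < r ->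
    \forall s \near t, horizon_cc r%:E s -> dom p s /\ y s = x s.
  move=> _ tr; near=> s => -[s0 _].
  have sr : s < r by near: s; exact: lt_nbhsl.
  by rewrite /y sr; split=> //; apply/domE; rewrite s0.
have yder t : horizon_cc r%:E t -> t < r -> ~ switching_time (signal p) t ->
    has_deriv_within (horizon_cc r%:E) y t (f (y t) (signal p t)).
  move=> Jt tr nosw; have yt : y t = x t by rewrite /y tr.
  apply: (has_deriv_within_near_eq (J_near t Jt tr)) => //; rewrite yt.
  by apply: xd => //; apply/domE; rewrite tr andbT; case: Jt.
have JE t : horizon_cc r%:E t <-> 0 <= t <= r.
  by rewrite /horizon_cc/= lee_fin; split=> [[-> ->]|/andP[-> ->]].
have y_cont : {within horizon_cc r%:E, continuous y}.
  apply/subspace_continuousP => t /[dup] Jt /JE/andP[t0].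
  rewrite le_eqVlt => /predU1P[->|tr].
    rewrite /from_subspace yr; apply/cvgrPdist_le => e e0.
    have : \forall s \near r, horizon_cc r%:E s -> `|z - y s| <= e; last by [].
    near=> s => /JE/andP[s0]; rewrite le_eqVlt => /predU1P[->|sr].
      by rewrite yr subrr normr0 ltW.
    have as_ : a < s by near: s; exact: lt_nbhsr.
    rewrite /y sr (le_trans (xz s _)) ?as_// -ler_pdivlMl// lerBlDr -lerBlDl.
    by apply/ltW; near: s; apply: lt_nbhsr; rewrite ltrBlDr ltrDl mulr_gt0 ?invr_gt0.
  have tD : dom p t by apply/domE; rewrite t0.
  have xt := (subspace_continuousP _ _).1 xc t tD.
  rewrite /from_subspace {2}/y tr; apply: cvg_trans xt => P /= HP.
  have {}HP : \forall s \near t, dom p s -> P (x s) by exact: HP.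
  have : \forall s \near t, horizon_cc r%:E s -> P (y s); last by [].
  near=> s => Js; have [||Ds ys] // := near (J_near t Jt tr) s.
  by rewrite ys; apply: (near HP s).
have y_sol : is_solution f (signal p) (horizon_cc r%:E) y.
  split=> //; first by exists r%:E; [rewrite lte_fin | right].
  move=> t /[dup] Jt /JE/andP[t0].
  rewrite le_eqVlt => /predU1P[->|tr]; last exact: yder.
  (* When [r] is not a switching time, the equation must hold at [r] too, with a one-sided
     derivative: the mode at [r] is still [g], and the mean value estimate on [[s, r]] compares the
     slope with [f z g]. *)
  move=> nosw; rewrite /has_deriv_within yr; have -> : signal p r = g.
    apply: (switching_free_constant_right ps a0 (ltW ar)) => u /andP[au].
    by rewrite le_eqVlt => /predU1P[->//|ur]; apply: a_max; rewrite au.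
  apply/cvgrPdist_le => e e0.
  have /cvgrPdist_le/(_ e e0)/nbhs_ballP[d /= d0 fd] := f_cont g z.
  have : \forall s \near r^', horizon_cc r%:E s ->
    `|f z g - (s - r)^-1 *: (y s - z)| <= e; last by [].
  near=> s => /JE/andP[s0 sr].
  have {}sr : s < r.
    by rewrite lt_neqAle sr andbT; near: s; exact: nbhs_dnbhs_neq.
  have as_ : a < s by near: s; apply: nbhs_dnbhs; exact: lt_nbhsr.
  have sd : M * (r - s) < d.
    rewrite -ltr_pdivlMl// ltrBlDr -ltrBlDl; near: s; apply: nbhs_dnbhs.
    by apply: lt_nbhsr; rewrite ltrBlDr ltrDl mulr_gt0 ?invr_gt0.
  have : `|y r - y s - (r - s) *: f z g| <= e * (r - s).
    apply: (rV_mean_value (g := fun u => f (y u) g)) => //; [exact: ltW| | |exact: ltW].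
      apply: continuous_subspaceW y_cont => u /=; rewrite in_itv/= => /andP[su ur].
      by apply/JE; rewrite ur (le_trans s0).
    move=> u /andP[su ur]; have Ju : horizon_cc r%:E u by apply/JE; lra.
    have au : a < u by exact: lt_trans su.
    split.
      have -> : g = signal p u.
        apply/esym/(switching_free_constant ps a0 a_max); first by rewrite ltW.
      apply: has_deriv_within_interior (yder u Ju ur (a_max _ _)); last by rewrite au.
      apply: filterS (near_in_itvoo (_ : u \in `]a, r[)); last by rewrite in_itv/= au.
      by move=> w; rewrite /= in_itv/= => /andP[aw wr]; apply/JE; lra.
    rewrite distrC; apply: fd; rewrite -ball_normE/= /y ur (le_lt_trans (xz u _)) ?au//.
    by rewrite (le_lt_trans _ sd)// ler_pM2l//; lra.
  by rewrite -yr slopeC; exact: slope_dist_le.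
have Jdom : horizon_cc r%:E = dom p.
  apply: p_ext y_sol _ _ => t /domE/andP[t0 tr]; last by rewrite /y tr.
  by apply/JE; rewrite t0 ltW.
have : dom p r by rewrite -Jdom; apply/JE; rewrite lexx ltW.
by move/domE; rewrite ltxx andbF.
Unshelve. all: by end_near. Qed.

(** * Uniform decrease of V *)

(** Along an ultrafilter every cluster point is a limit. A single ultrafilter thus gives limits at
    all times at once, with no extraction of subsequences. *)
Lemma compact_ultra_cvg {T : Type} {U : topologicalType} (F : set_system T)
    (u : T -> U) (K : set U) :
  UltraFilter F -> compact K -> (\forall k \near F, K (u k)) ->
  exists l : U, u k @[k --> F] --> l.
Proof.
move=> UF Kc uK; have [l [_ lcl]] := Kc _ (fmap_proper_filter u _) uK.
exists l => B lB.
have [//|nB] := in_ultra_setVsetC (u @^-1` B) UF.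
have nB' : (u @ F) (~` B) by exact: nB.
by have [z []] := lcl _ _ nB' lB.
Qed.

(** Distinguishability looks forward from time 0, but the window is symmetric about 0: the
    derivatives of the limit curve, and of V along it, are then two-sided at 0 as well. *)
Lemma distinguishable_decrease {R : realType} n (f : 'rV[R]_n -> 'rV[R]_n)
    (Z : set 'rV[R]_n) (V W : 'rV[R]_n -> R) (C eps delta : R) :
  continuous f -> closed Z -> (forall xi, differentiable V xi) ->
  (forall xi, 0 <= W xi) -> (forall xi, Z xi -> 'd V xi (f xi) <= - W xi) ->
  zero_small_time_distinguishable f W -> 0 < eps -> 0 < delta ->
  exists2 eta, 0 < eta & forall y : R -> 'rV[R]_n,
    (forall t, - delta <= t <= delta ->
       [/\ is_derive t 1 y (f (y t)), Z (y t) & enorm (y t) <= C]) ->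
    eps <= enorm (y 0) -> eta <= V (y (- delta)) - V (y delta).
Proof.
move=> f_cont Z_closed V_diff W_ge0 V_decay fW eps0 d0; apply: contrapT => noeta.
have /choice[ys ysP] (k : nat) : exists y : R -> 'rV[R]_n,
    [/\ forall t, - delta <= t <= delta ->
          [/\ is_derive t 1 y (f (y t)), Z (y t) & enorm (y t) <= C],
        eps <= enorm (y 0) & V (y (- delta)) - V (y delta) < k.+1%:R^-1].
  apply: contrapT => noy; apply: noeta.
  exists k.+1%:R^-1; first by rewrite invr_gt0 ltr0n.
  move=> y yP y0; rewrite leNgt; apply/negP => Vy; apply: noy.
  by exists y.
have [F [UF ooF]] := @ultraFilterLemma nat \oo _.
have /choice[y yP] (t : R) : exists l : 'rV[R]_n, - delta <= t <= delta ->
    ys k t @[k --> F] --> l.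
  have [tI|ntI] := pselect (- delta <= t <= delta); last by exists 0.
  have [|l yl] := compact_ultra_cvg (u := ys ^~ t) UF (@enorm_ball_compact R n C).
    by near=> k; have [/(_ t tI)[]] := ysP k.
  by exists l.
have V_cont : continuous V by move=> xi; exact: differentiable_continuous.
have Vys_nincr k s t : - delta <= s -> s <= t -> t <= delta ->
    V (ys k t) <= V (ys k s).
  move=> ds st td; have [ykP _ _] := ysP k.
  apply: (@is_derive1_le0_nincr _ (fun u => V (ys k u))
      (fun u => 'd V (ys k u) (f (ys k u)))) => //.
    apply/continuous_in_subspaceT => u /set_mem; rewrite /= in_itv/= => /andP[su ut].
    apply: continuous_comp; last exact: V_cont.
    by have [|/is_derive1_continuous] := ykP u; first lra.
  move=> u /andP[su ut]; have [|yd Zy _] := ykP u; first lra.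
  split; first exact: is_derive1_diff (V_diff _) yd.
  by rewrite (le_trans (V_decay _ Zy))// oppr_le0.
have Vyc t : - delta <= t <= delta -> V (ys k t) @[k --> F] --> V (y t).
  by move=> /yP yt; exact: cvg_comp yt (V_cont _).
(* V is nonincreasing along the limit, and its total decrease is at most the limit of [1 / (k + 1)],
   that is 0. *)
have V_const t : - delta <= t <= delta -> V (y t) = V (y 0).
  have Vle s u : - delta <= s -> s <= u -> u <= delta -> V (y u) <= V (y s).
    move=> ds su ud; apply: (ler_cvg_to (Vyc u _) (Vyc s _)); [lra|lra|].
    by near=> k; exact: Vys_nincr.
  have V0 : V (y (- delta)) - V (y delta) <= 0.
    have lim : V (ys k (- delta)) - V (ys k delta) @[k --> F] -->
        V (y (- delta)) - V (y delta) by apply: cvgB; apply: Vyc; lra.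
    apply: (ler_cvg_to lim (cvg_trans (cvg_app _ ooF) cvg_harmonic)).
    by near=> k; have [_ _ /ltW] := ysP k.
  move=> /andP[dt td].
  have ? := Vle (- delta) t (lexx _) dt td; have ? := Vle t delta dt td (lexx _).
  have ? := Vle (- delta) 0; have ? := Vle 0 delta.
  by apply/eqP; rewrite eq_le; apply/andP; split; lra.
have [M M0 fM] := continuous_ball_bounded C f_cont.
have ys_cont k s t : - delta <= s -> t <= delta -> {within `[s, t], continuous (ys k)}.
  move=> ds td; apply/continuous_in_subspaceT => u /set_mem.
  rewrite /= in_itv/= => /andP[su ut].
  by have [/(_ u) + _ _] := ysP k; case=> [|/is_derive1_continuous]; first lra.
have ys_lip k s t : - delta <= s -> s <= t -> t <= delta ->
    `|ys k t - ys k s| <= M * (t - s).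
  move=> ds st td; rewrite -[ys k t - _]subr0 -[X in `|_ - X|](scaler0 _ (t - s)).
  apply: (rV_mean_value (g := fun u => f (ys k u))) => //; [exact: ys_cont| |exact: ltW].
  move=> u /andP[su ut]; have [/(_ u) + _ _] := ysP k; case=> [|yd _ yC]; first lra.
  by split; [exact: yd | rewrite subr0 fM].
have yder t : - delta < t < delta -> is_derive t 1 y (f (y t)).
  move=> /andP[dt td]; apply/is_derive1_slopeP/cvgrPdist_le => e e0.
  have /cvgrPdist_le/(_ e e0)/nbhs_ballP[d /= d0' fd] := f_cont (y t).
  (* The curves [ys k] share the Lipschitz constant [M], so for [F]-most [k] they stay within [d] of
     [y t] near time [t]: one half of [d] covers their motion, the other the distance from [ys k t]
     to [y t]. The mean value estimate then passes to the limit. *)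
  have est a b : - delta <= a -> a <= b -> b <= delta ->
      (forall u, a <= u <= b -> M * `|u - t| < d / 2) ->
      `|y b - y a - (b - a) *: f (y t)| <= e * (b - a).
    move=> da ab bd tab.
    have lim : `|ys k b - ys k a - (b - a) *: f (y t)| @[k --> F] -->
        `|y b - y a - (b - a) *: f (y t)|.
      apply: cvg_norm; apply: cvgB; last exact: cvg_cst.
      by apply: cvgB; apply: yP; lra.
    apply: (ler_cvg_to lim (cvg_cst _)).
    have yst : \forall k \near F, `|y t - ys k t| < d / 2.
      have /cvgrPdist_lt : ys k t @[k --> F] --> y t by apply: yP; lra.
      by apply; rewrite divr_gt0.
    near=> k; apply: (rV_mean_value (g := fun u => f (ys k u))) => //; last exact: ltW.
      exact: ys_cont.
    move=> u /andP[au ub]; have [/(_ u) + _ _] := ysP k; case=> [|yd _ _]; first lra.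
    split=> //; rewrite distrC; apply: fd; rewrite -ball_normE/=.
    rewrite -(subrKA (ys k t)) (le_lt_trans (ler_normD _ _))// [d]splitr ltrD//.
      by near: k.
    apply: le_lt_trans (tab u _); last by rewrite !ltW.
    have [ut|/ltW tu] := leP u t.
      by rewrite (distrC u) ger0_norm ?subr_ge0// ys_lip//; lra.
    by rewrite (distrC (ys k t)) ger0_norm ?subr_ge0// ys_lip//; lra.
  have c0 : 0 < M^-1 * (d / 2) by rewrite mulr_gt0 ?invr_gt0 ?divr_gt0.
  near=> s; have ds : - delta < s by near: s; apply: nbhs_dnbhs; exact: lt_nbhsr.
  have sd : s < delta by near: s; apply: nbhs_dnbhs; exact: lt_nbhsl.
  have st : s != t by near: s; exact: nbhs_dnbhs_neq.
  have std : M * `|s - t| < d / 2.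
    rewrite -ltr_pdivlMl// distrC; near: s; apply: nbhs_dnbhs.
    exact: (nbhsx_ballx t _ c0).
  move: st; rewrite neq_lt => /orP[st|ts]; [rewrite slopeC|];
    apply: slope_dist_le => //; apply: est; rewrite ?ltW// => u /andP[u1 u2];
    apply: le_lt_trans std; rewrite ler_pM2l//.
    by rewrite !(distrC _ t) !ger0_norm ?subr_ge0//; lra.
  by rewrite !ger0_norm ?subr_ge0//; lra.
(* As V is constant along [y], the left side of the decay inequality is 0, which forces [W <= 0]. *)
have W0 t : - delta < t < delta -> W (y t) = 0.
  move=> /[dup] tI /andP[dt td].
  have s1 := (is_derive1_slopeP _ _ _).1 (is_derive1_diff (V_diff _) (yder t tI)).
  have s0 : (s - t)^-1 *: ((V \o y) s - (V \o y) t) @[s --> t^'] --> (0 : R).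
    suff : \forall s \near t^', (s - t)^-1 *: ((V \o y) s - (V \o y) t) = 0 :> R.
      exact: cvg_near_cst.
    near=> s; have ds : - delta < s by near: s; apply: nbhs_dnbhs; exact: lt_nbhsr.
    have sd : s < delta by near: s; apply: nbhs_dnbhs; exact: lt_nbhsl.
    by rewrite /= !V_const ?subrr ?scaler0//; lra.
  have dV0 := cvg_unique (@norm_hausdorff _ _) s1 s0.
  have Zy : Z (y t).
    apply: (closed_cvg Z Z_closed _ _ (yP t _)); last lra.
    by near=> k; have [/(_ t)[]] := ysP k; first lra.
  by have := V_decay _ Zy; have := W_ge0 (y t); rewrite dV0; lra.
have y0 : y 0 = 0.
  apply: (fW delta) => // t /andP[t0 td].
    by apply/is_derive_has_deriv_within/yder; lra.
  by apply: W0; lra.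
have : eps <= enorm (y 0).
  apply: (closed_cvg [set r : R | eps <= r] (@closed_ge R _) _ _
    (cvg_comp _ _ (yP 0 _) (@enorm_continuous R n (y 0)))); last lra.
  by near=> k; have [_] := ysP k.
by rewrite y0 enorm0 leNgt eps0.
Unshelve. all: by end_near. Qed.

(** * Attractivity *)

Lemma is_derive1_shift {R : realType} {U : normedModType R} (x : R -> U)
    (c t : R) (v : U) :
  is_derive (c + t) 1 x v -> is_derive t 1 (fun s => x (c + s)) v.
Proof.
have E :
    (fun h : R =>
       h^-1 *: (((fun s => x (c + s)) \o shift t) (h *: 1) - x (c + t))) =
    (fun h : R => h^-1 *: ((x \o shift (c + t)) (h *: 1) - x (c + t))).
  by apply/funext => h; rewrite /= addrCA.
by move=> [xd xv]; split; [rewrite /derivable E | rewrite /derive E].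
Qed.

(** Pigeonhole: an open interval of length [tauD] has at most [N0 + 1] switching times, so one of
    its [N0 + 2] open pieces of length [d] has none, and [c] is the midpoint of that piece. *)
Lemma average_dwell_time_switching_free {R : realType} m (sigma : R -> 'I_m)
    (tauD u : R) (N0 : nat) (d := tauD / N0.+2%:R) :
  0 < tauD -> average_dwell_time tauD N0 sigma -> 0 <= u ->
  exists c, [/\ u + d / 2 <= c, c + d / 2 <= u + tauD &
    forall r, c - d / 2 < r < c + d / 2 -> ~ switching_time sigma r].
Proof.
move=> tau0 [_ adt] u0; apply: contrapT => noc.
have d0 : 0 < d by rewrite divr_gt0.
have dE : tauD = d * N0.+2%:R by rewrite divfK.
(* If no piece were free, [r] would pick a switching time in each, and these are distinct because
   the pieces are disjoint. The value 0 for larger [j] is a dummy. *)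
have /choice[r rP] (j : nat) : exists r : R, (j < N0.+2)%N ->
    [/\ switching_time sigma r, u + d * j%:R < r & r < u + d * j.+1%:R].
  have [jN|jN] := ltnP j N0.+2; last by exists 0.
  apply: contrapT => nor; apply: noc; exists (u + d * j%:R + d / 2).
  have jN' : j.+1%:R <= N0.+2%:R :> R by rewrite ler_nat.
  have dj : d * j.+1%:R <= tauD by rewrite dE ler_pM2l.
  have jd : 0 <= d * j%:R by rewrite mulr_ge0// ltW.
  rewrite -natr1 mulrDr mulr1 in dj; split; [lra|lra|].
  move=> s sI sw; apply: nor; exists s => _; split => //; first lra.
  by rewrite -natr1; lra.
have [k Ak kN] := adt u (u + tauD) u0 (ltr_pwDr tau0 (lexx _)).
have r_inj : {in `I_N0.+2 &, injective r}.
  have r_lt i j : (j < N0.+2)%N -> (i < j)%N -> r i < r j.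
    move=> jN ij; have [_ _ ri] := rP i (ltn_trans ij jN); have [_ rj _] := rP j jN.
    apply: lt_trans ri (le_lt_trans _ rj).
    by rewrite lerD2l ler_pM2l// ler_nat.
  move=> i j /set_mem/= iN /set_mem/= jN rij.
  by case: (ltngtP i j) => // /r_lt; [move=> /(_ jN)|move=> /(_ iN)];
    rewrite rij ltxx.
have : (`I_N0.+2 #<= `I_k)%card.
  have /card_eqPle[_ rI] := inj_card_eq r_inj.
  apply: card_le_trans rI _; have /card_eqPle[Ak' _] := Ak.
  apply: card_le_trans Ak'; apply: subset_card_le => _ [j /= jN <-].
  have [sw rj jr] := rP j jN; split=> //; rewrite /= in_itv/=.
  have jN' : j.+1%:R <= N0.+2%:R :> R by rewrite ler_nat.
  have dj : d * j.+1%:R <= tauD by rewrite dE ler_pM2l.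
  have jd : 0 <= d * j%:R by rewrite mulr_ge0// ltW.
  by apply/andP; split; lra.
rewrite card_le_II leqNgt => /negP; apply; rewrite ltnS -(ler_nat R).
by rewrite (le_trans kN)// addrAC subrr add0r divff ?gt_eqF// natr1.
Qed.

Lemma iter_cancel {T : Type} (g h : T -> T) k :
  cancel g h -> cancel (iter k g) (iter k h).
Proof. by move=> gK x; elim: k => // k IHk; rewrite iterSr [iter k.+1 g x]iterS gK. Qed.

Lemma iter_mono {R : realType} (g : R -> R) k :
  {mono g : s t / s <= t} -> {mono iter k g : s t / s <= t}.
Proof. by move=> gmono s t; elim: k => //= k IHk; rewrite gmono. Qed.

Lemma classKoo_add {R : realType} (a b : R -> R) :
  classKoo a -> classKoo b -> classKoo (fun s => a s + b s).
Proof.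
move=> [[ac ai a0] au] [[bc bi b0] bu]; split; first split.
- apply/subspace_continuousP => t t0; apply: cvgD.
    exact: (subspace_continuousP _ _).1 ac t t0.
  exact: (subspace_continuousP _ _).1 bc t t0.
- by move=> s t s0 st; rewrite ltrD ?ai ?bi.
- by rewrite a0 b0 addr0.
- move=> M; have [s s0 Ms] := au M; exists s => //.
  rewrite (lt_le_trans Ms)// lerDl.
  by move: s0; rewrite le_eqVlt => /predU1P[<-|s0]; rewrite ?b0// -b0 ltW// bi.
Qed.

Section attractivity.
Context {R : realType} {n m : nat}.
Variables (f : 'rV[R]_n -> 'I_m -> 'rV[R]_n) (F : set (trajectory R n m)).
Variables (chi : 'I_m -> set 'rV[R]_n) (V : 'rV[R]_n -> 'I_m -> R).
Variables (W : 'I_m -> 'rV[R]_n -> R) (g1 g2 alpha alphaV : R -> R).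
Hypothesis f_cont : forall g, continuous (f ^~ g).
Hypothesis chi_closed : forall g, closed (chi g).
Hypothesis F_chi : F `<=` covered_trajectory f chi.
Hypothesis V_diff : forall g xi, differentiable (V ^~ g) xi.
Hypothesis F_nincr : forall p, F p -> forall ti ti1 tj : R,
  next_switching_time (signal p) ti ti1 -> switching_time (signal p) tj ->
  ti < tj -> dom p tj -> signal p ti = signal p tj ->
  V (curve p tj) (signal p tj) <= V (curve p ti1) (signal p ti).
Hypothesis W_ge0 : forall g xi, 0 <= W g xi.
Hypothesis V_decay :
  forall xi g, chi g xi -> 'd (V ^~ g) xi (f xi g) <= - W g xi.
Hypothesis W_dist : forall g, zero_small_time_distinguishable (f ^~ g) (W g).
Hypothesis g1_ge0 : forall r, 0 <= r -> 0 <= g1 r.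
Hypothesis g2_homo : {homo g2 : r s / r <= s}.
Hypothesis V_bounds :
  forall xi g, chi g xi -> g1 (enorm xi) <= V xi g <= g2 (enorm xi).
Hypothesis alphaK : cancel alphaV alpha.
Hypothesis alpha_mono : {mono alpha : r s / r <= s}.
Hypothesis alpha0 : alpha 0 = 0.
Hypothesis F_complete : forall p, F p -> end_time p = +oo%E.
Hypothesis F_stable : forall p, F p -> forall t0 t, 0 <= t0 -> t0 <= t ->
  enorm (curve p t) <= alpha (enorm (curve p t0)).

Lemma complete_dom p t : F p -> 0 <= t -> dom p t.
Proof. by move=> Fp t0; split=> //; rewrite (F_complete Fp) ltry. Qed.

Lemma V_derivative_le0 xi g : chi g xi -> 'd (V ^~ g) xi (f xi g) <= 0.
Proof. by move=> /V_decay/le_trans; apply; rewrite oppr_le0. Qed.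

(* A block of length [tauD] contains a switching-free interval of length
   [2 * delta], on which [V] at the active mode loses [eta] unless the curve gets
   close to the origin. Since [V] at a fixed mode never increases from one
   activation to the next, each mode allows a bounded number of such losses. *)
Lemma average_dwell_time_attractive (tauD r eps : R) (N0 : nat) :
  0 < tauD -> 0 < eps -> exists T, forall p, F p ->
    average_dwell_time tauD N0 (signal p) ->
    forall t0 t, 0 <= t0 -> enorm (curve p t0) <= r -> t0 + T <= t ->
    enorm (curve p t) <= eps.
Proof.
(* By stability the curve stays in the [C]-ball from [t0] on, and a single visit to the open
   [e]-ball keeps it within [eps] from then on. *)
move=> tau0 eps0; pose C := alpha r; pose e := alphaV eps.
(* Taking a quarter of the length [d], not a half, puts the closed window of radius [delta] inside
   the open switching-free interval. *)
pose d := tauD / N0.+2%:R; pose delta := d / 4.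
have d0 : 0 < d by rewrite divr_gt0.
have delta0 : 0 < delta by rewrite divr_gt0.
have e0 : 0 < e by rewrite -(leW_mono alpha_mono) alphaK alpha0.
have /choice[etas /all_and2[etas0 etasP]] (g : 'I_m) : exists eta, 0 < eta /\
    forall y : R -> 'rV[R]_n,
    (forall t, - delta <= t <= delta ->
       [/\ is_derive t 1 y (f (y t) g), chi g (y t) & enorm (y t) <= C]) ->
    e <= enorm (y 0) -> eta <= V (y (- delta)) g - V (y delta) g.
  have [eta eta0 etaP] := distinguishable_decrease C (@f_cont g) (@chi_closed g)
    (V_diff g) (W_ge0 g) (fun xi => @V_decay xi g) (@W_dist g) e0 delta0.
  by exists eta.
pose eta := \big[Num.min/1]_g etas g.
have eta0 : 0 < eta by apply: lt_bigmin => // g _.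
have eta_le g : eta <= etas g by exact: bigmin_le.
(* V at the active mode stays between 0 and [g2 C], so no mode can lose [eta] as many as [q]
   times. *)
have [q qP] : exists q : nat, g2 C < eta * q%:R.
  exists (Num.truncn (g2 C / eta)).+1; rewrite -ltr_pdivrMl// mulrC.
  exact: truncnS_gt.
(* One block more than [m] modes could absorb with [q] losses each. *)
pose B := (m * q).+1; exists (B%:R * tauD) => p Fp pN t0 t t00 xr tT.
have [pmax pchi] := F_chi Fp; have [ps _ _] := pmax.
suff [s [s0 st xs]] : exists s, [/\ t0 <= s, s <= t0 + B%:R * tauD &
    enorm (curve p s) < e].
  have /le_trans : enorm (curve p t) <= alpha (enorm (curve p s)).
    by apply: F_stable => //; [exact: le_trans s0 | exact: le_trans tT].
  by apply; rewrite -[leRHS]alphaK alpha_mono ltW.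
apply: contrapT => nos.
have e_le s : t0 <= s -> s <= t0 + B%:R * tauD -> e <= enorm (curve p s).
  by move=> s0 st; rewrite leNgt; apply/negP => xs; apply: nos; exists s.
have /choice[c cP] (j : nat) := average_dwell_time_switching_free tau0 pN
  (addr_ge0 t00 (mulr_ge0 (ler0n _ j) (ltW tau0))).
pose gam j := signal p (c j).
pose cnt g j := (\sum_(i < j) (gam i == g))%N.
have x_le s : t0 <= s -> enorm (curve p s) <= C.
  by move=> s0; rewrite (le_trans (F_stable Fp t00 s0))// alpha_mono.
have V_le s : t0 <= s -> 0 <= V (curve p s) (signal p s) <= g2 C.
  move=> s0; have sD : dom p s by apply: complete_dom => //; exact: le_trans t00 _.
  have /V_bounds/andP[V1 V2] := pchi _ sD.
  rewrite (le_trans (g1_ge0 (enorm_ge0 _)) V1)/= (le_trans V2)//.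
  exact/g2_homo/x_le.
have V_same s u : t0 <= s -> s <= u -> signal p s = signal p u ->
    V (curve p u) (signal p u) <= V (curve p s) (signal p s).
  move=> s0 su; apply: (V_nincr_same_mode chi_closed V_diff V_derivative_le0
    (F_chi Fp)) => //.
  - exact: F_nincr.
  - exact: le_trans t00 _.
  - by apply: complete_dom => //; rewrite (le_trans t00)// (le_trans s0).
have block j : (j < B)%N ->
    [/\ t0 + j%:R * tauD <= c j - delta, c j + delta <= t0 + j.+1%:R * tauD,
        signal p (c j - delta) = gam j, signal p (c j + delta) = gam j &
        V (curve p (c j + delta)) (gam j) <= V (curve p (c j - delta)) (gam j) - eta].
  move=> jB; have [cj1 cj2 cj_free] := cP j.
  rewrite -/d in cj1 cj2 cj_free.
  have dE : d = delta * 4 by rewrite divfK.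
  have jtau : 0 <= j%:R * tauD by rewrite mulr_ge0// ltW.
  have a0 : 0 <= c j - d / 2 by lra.
  have jBtau : j.+1%:R * tauD <= B%:R * tauD by rewrite ler_pM2r// ler_nat.
  have jS : j.+1%:R * tauD = j%:R * tauD + tauD by rewrite -natr1 mulrDl mul1r.
  have sgam s : c j - delta <= s <= c j + delta -> signal p s = gam j.
    move=> sI; rewrite /gam !(switching_free_constant ps a0 cj_free (t := _))//; lra.
  have bD : dom p (c j + d / 2) by apply: complete_dom => //; lra.
  split; [lra|lra|apply: sgam; lra|apply: sgam; lra|].
  rewrite lerBrDl -lerBrDr (le_trans (eta_le (gam j)))//.
  have := etasP (gam j) (fun s => curve p (c j + s)) _ _; apply.
  - move=> s sI; have cs : t0 <= c j + s by lra.
    split; last exact: x_le.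
      apply: is_derive1_shift; rewrite -(sgam (c j + s)); last lra.
      rewrite (switching_free_constant ps a0 cj_free (t := c j + s)); last lra.
      by apply: (trajectory_derive pmax a0 bD cj_free); lra.
    rewrite -(sgam (c j + s)); last lra.
    by apply: pchi; apply: complete_dom => //; lra.
  - by apply: e_le; rewrite addr0; lra.
(* By induction on the blocks: each loss at mode [g] permanently lowers the ceiling on V at [g]. The
   first clause, from [0 <= V] right after a loss, bounds the number of losses. *)
have count j g : (j <= B)%N -> eta * (cnt g j)%:R <= g2 C /\
    forall s, t0 + j%:R * tauD <= s -> signal p s = g ->
      V (curve p s) g <= g2 C - eta * (cnt g j)%:R.
  elim: j => [_|j IHj jB].
    rewrite /cnt big_ord0 mulr0 subr0 mul0r addr0; split=> [|s s0 <-].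
      by have /andP[V0 VC] := V_le t0 (lexx _); exact: le_trans VC.
    by have /andP[] := V_le s s0.
  have [IH1 IH2] := IHj (ltnW jB); have [cj1 cj2 s1 s2 Vd] := block j jB.
  have jtau : 0 <= j%:R * tauD by rewrite mulr_ge0// ltW.
  have jS : j.+1%:R * tauD = j%:R * tauD + tauD by rewrite -natr1 mulrDl mul1r.
  rewrite /cnt big_ord_recr/= -/(cnt g j); have [gj|_] := eqVneq (gam j) g; last first.
    by rewrite addn0; split=> // s s0; apply: IH2; lra.
  rewrite addn1 -natr1 mulrDr mulr1.
  have := IH2 _ cj1; rewrite s1 gj => /(_ erefl) V1; rewrite gj in Vd s1 s2.
  have t0b : t0 <= c j + delta by lra.
  split=> [|s s0 sg]; first by have /andP[] := V_le _ t0b; rewrite s2; lra.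
  have bs : c j + delta <= s by lra.
  by have := V_same _ _ t0b bs; rewrite s2 sg => /(_ erefl); lra.
(* Every block is counted for exactly one mode, so exchanging the sums gives the number of
   blocks. *)
have cntB : (\sum_g cnt g B = B)%N.
  rewrite /cnt exchange_big/= (eq_bigr (fun=> 1%N)) ?sum1_card ?card_ord// => i _.
  by rewrite (bigD1 (gam i))//= eqxx big1 ?addn0// => g /negPf; rewrite eq_sym => ->.
have : (B <= m * q)%N.
  rewrite -{1}cntB -[X in (_ <= X * _)%N]card_ord -sum_nat_const; apply: leq_sum => g _.
  have [cB _] := count B g (leqnn _).
  by rewrite ltnW// -(ltr_nat R) -(ltr_pM2l eta0) (le_lt_trans cB).
by rewrite ltnn.
Qed.
End attractivity.

(** * Assembling stability, completeness and attractivity *)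

Theorem theorem2p3 (R : realType) (n m : nat)
    (f : 'rV[R]_n -> 'I_m -> 'rV[R]_n)
    (F : set (trajectory R n m))
    (chi : 'I_m -> set 'rV[R]_n)
    (V : 'rV[R]_n -> 'I_m -> R)
    (W : 'I_m -> 'rV[R]_n -> R)
    (f_cont : forall g, continuous (f ^~ g))
    (F_max : F `<=` maximal_trajectory f)
    (chi_cover : closed_covering chi)
    (F_chi : F `<=` covered_trajectory f chi)
    (f0 : forall g, chi g 0 -> f 0 g = 0)
    (F_adt : F `<=` adt_trajectory_any f)
    (V_lyap : weak_lyapunov_like f chi F V)
    (W_cont : forall g, continuous (W g))
    (W_ge0 : forall g xi, 0 <= W g xi)
    (V_decay : forall xi g, chi g xi -> 'd (V ^~ g) xi (f xi g) <= - W g xi)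
    (W_dist : forall g, zero_small_time_distinguishable (f ^~ g) (W g)) :
  globally_asymptotically_stable F /\
  ((exists (tauD : R) (N0 : nat),
      [/\ 0 < tauD, (0 < N0)%N & F `<=` adt_trajectory f tauD N0]) ->
   globally_uniformly_asymptotically_stable F).
Proof.
have [chi_closed _] := chi_cover.
have [V_C1 [a1 [a2 [a1K a2K a12]]] V_nincr F_nincr] := V_lyap.
have V_diff g xi : differentiable (V ^~ g) xi := (V_C1 g).1 xi.
have [g1 [h1 [g1K h1K g1mono g1E]]] := classKoo_extension a1K.
(* Taking a1 + a2 instead of a2 makes [h1 o g2] at least the identity. *)
have [g2 [h2 [g2K h2K g2mono g2E]]] := classKoo_extension (classKoo_add a1K a2K).
have a1_0 : a1 0 = 0 by have [[]] := a1K.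
have a2_0 : a2 0 = 0 by have [[]] := a2K.
have g1_0 : g1 0 = 0 by rewrite g1E.
have g2_0 : g2 0 = 0 by rewrite g2E// a1_0 a2_0 addr0.
have a1_ge0 r : 0 <= r -> 0 <= a1 r by move=> r0; rewrite -g1E// -g1_0 g1mono.
have a2_ge0 r : 0 <= r -> 0 <= a2 r.
  move=> r0; have [[_ a2i _] _] := a2K.
  by move: r0; rewrite le_eqVlt => /predU1P[<-|r0]; rewrite ?a2_0// -a2_0 ltW ?a2i.
have g12 r : 0 <= r -> g1 r <= g2 r.
  by move=> r0; rewrite g1E// g2E// lerDl a2_ge0.
have V_bounds xi g : chi g xi -> g1 (enorm xi) <= V xi g <= g2 (enorm xi).
  move=> /a12/andP[V1 V2]; rewrite g1E ?g2E ?enorm_ge0// V1 (le_trans V2)//.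
  by rewrite lerDr a1_ge0// enorm_ge0.
pose alpha := iter m (h1 \o g2); pose alphaV := iter m (h2 \o g1).
have alphaK : cancel alpha alphaV by apply: iter_cancel => r /=; rewrite h1K g2K.
have alphaVK : cancel alphaV alpha by apply: iter_cancel => r /=; rewrite h2K g1K.
have alpha_mono : {mono alpha : r s / r <= s}.
  by apply: iter_mono => r s /=; rewrite (can_mono h1K g1mono) g2mono.
have alpha0 : alpha 0 = 0.
  by rewrite /alpha; move: {1}m => k; elim: k => //= k ->; rewrite g2_0 -g1_0 g1K.
have g2_homo : {homo g2 : r s / r <= s} by move=> r s rs; rewrite g2mono.
have g1_ge0 r : 0 <= r -> 0 <= g1 r by move=> r0; rewrite -g1_0 g1mono.
(* The bound is first stated within the domain, since completeness is itself deduced from it. *)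
have stable p : F p -> forall t0 t, 0 <= t0 -> t0 <= t -> dom p t ->
    enorm (curve p t) <= alpha (enorm (curve p t0)).
  move=> Fp t0 t t00 t0t tD; have [_ pchi] := F_chi _ Fp.
  have /V_bounds/andP[V1 _] := pchi _ tD.
  rewrite -g1mono (le_trans V1)//.
  apply: (V_mode_count_bound chi_closed V_diff V_nincr (F_chi _ Fp) (F_nincr p Fp)
    (A := [set: 'I_m]%SET)) => //.
  - by rewrite cardsT card_ord.
  - by move=> s _; rewrite inE.
have complete p : F p -> end_time p = +oo%E.
  move=> Fp; have pmax := F_max _ Fp.
  apply: (bounded_trajectory_complete f_cont pmax) => t tD.
  by apply: (stable p Fp 0 t) => //; case: tD.
have {}stable p : F p -> forall t0 t, 0 <= t0 -> t0 <= t ->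
    enorm (curve p t) <= alpha (enorm (curve p t0)).
  move=> Fp t0 t t00 t0t; apply: stable => //; split; first exact: le_trans t0t.
  by rewrite complete// ltry.
have attractive := average_dwell_time_attractive f_cont chi_closed F_chi V_diff
  F_nincr W_ge0 V_decay W_dist g1_ge0 g2_homo V_bounds alphaVK alpha_mono alpha0
  complete stable.
split; [split|].
- exists alpha; first exact: classKoo_increasing_bij alphaVK alpha_mono alpha0.
  by move=> p Fp; split; [exact: complete | exact: stable].
(* Convergence is claimed one trajectory at a time, so each may use its own dwell time and chatter
   bound. *)
- move=> p Fp; have [tauD [N0 [tau0 _ [_ pN]]]] := F_adt _ Fp.
  apply/cvgrPdist_le => e e0.
  have [T TP] := attractive tauD (enorm (curve p 0)) e N0 tau0 e0.
  near=> t; have Tt : T <= t.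
    by near: t; apply: nbhs_pinfty_ge; rewrite num_real.
  rewrite sub0r normrN (le_trans (le_norm_enorm _))//.
  by apply: (TP p Fp pN 0 t); rewrite ?add0r.
- move=> [tauD [N0 [tau0 _ F_N0]]].
  (* [G] records initial norm, elapsed time and final norm over all trajectories and initial times.
     Stability bounds it by [alpha], and attractivity makes it decay uniformly for bounded initial
     norms, as [classKL_majorant] requires. *)
  pose G s t v := exists p t0, [/\ F p, 0 <= t0, 0 <= t,
    s = enorm (curve p t0) & v = enorm (curve p (t0 + t))].
  have [|r e e0|b bKL bP] := @classKL_majorant R alpha alphaV G alphaK alphaVK
    alpha_mono alpha0.
  + move=> s t v [p [t0 [Fp t00 t_ge0 -> ->]]]; split; [exact: enorm_ge0..|].
    by apply: stable => //; rewrite lerDl.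
  + have [T TP] := attractive tauD r e N0 tau0 e0.
    exists T => s t v [p [t0 [Fp t00 t_ge0 -> ->]]] sr Tt.
    have [_ pN] := F_N0 p Fp.
    by apply: (TP p Fp pN t0) => //; rewrite lerD2l.
  + exists b => // p Fp; split=> [|t0 t t00 t0t]; first exact: complete.
    apply: bP; exists p, t0; split=> //; first by rewrite subr_ge0.
    by rewrite addrC subrK.
Unshelve. all: by end_near. Qed.
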